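(* Let $\mu$ be an integer partition, let $W_\mu(\mathbf{x};q)$ be the $q$-Whittaker symmetric function and let $W_\mu=\sum_{\nu\vdash|\mu|}a_{\mu\nu}(q)\,m_\nu$ be its expansion in monomial symmetric functions. Then for every partition $\nu$ with $|\nu|=|\mu|$, $$b_{\mu\nu}(q)=\frac{\prod_{i\ge 1}[\nu_i]_q!}{\prod_{i\geq 1}[\mu_i-\mu_{i+1}]_q!}\,a_{\mu\nu}(q).$$
   Context: $q$ is a formal variable. $[n]_q=1+q+\cdots+q^{n-1}$, $[n]_q!=\prod_{i=1}^n[i]_q$; ${n\brack k}_q$ is the $q$-binomial coefficient and ${n\brack \beta_1,\beta_2,\ldots}_q=[n]_q!/\prod_j[\beta_j]_q!$ the $q$-multinomial coefficient (for nonnegative integers $\beta_j$ with sum $n$). The $q$-Whittaker function is the specialization $W_\mu(\mathbf{x};q)=P_\mu(\mathbf{x};q,0)$ of the Macdonald polynomial $P_\mu(\mathbf{x};q,t)$. Recalled from Macdonald's book (VI.(7.13')): for $\nu=(\nu_1,\ldots,\nu_k)$, $a_{\mu\nu}(q)=\sum\prod_{j=1}^k\psi_{\mu^j/\mu^{j-1}}(q)$, summed over all chains of partitions $\emptyset=\mu^0\subseteq\mu^1\subseteq\cdots\subseteq\mu^k=\mu$ such that $\mu^j/\mu^{j-1}$ is a horizontal strip of size $\nu_j$ (no two cells in the same column), where $\psi_{\mu/\rho}(q)=\prod_{i\ge1}{\mu_i-\mu_{i+1}\brack \mu_i-\rho_i}_q$. The polynomial $b_{\mu\nu}(q)$, for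 partitions with $|\mu|=|\nu|$, is defined by $b_{\mu\nu}(q)=\sum_{T\in\mathrm{SSYT}(\mu,\nu)}r_q(T)s_q(T)$, where $\mathrm{SSYT}(\mu,\nu)$ is the set of semistandard tableaux of shape $\mu$ and content $\nu$ (rows weakly increasing, columns strictly increasing, entry $i$ appearing $\nu_i$ times). Here, if $b_{ij}$ is the entry of $T$ in row $i$ and column $j$, one sets for each cell $(i,j)$ with $i\ge2$: $r_{ij}(T)=\#\{j': j'\ge j,\ b_{i-1,j'}<b_{ij}\}$, and $r_q(T)=\prod_{(i,j):\,i\ge2}[r_{ij}(T)]_q$ (product over cells of $T$ in rows $\ge2$). If $\beta^i_j$ is the number of occurrences of $i$ in row $j$ of $T$, then $s_q(T)=\prod_{i\ge1}{\nu_i\brack \beta^i_1,\beta^i_2,\ldots}_q$. *)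

(* Defs.v *)
From mathcomp Require Import all_boot all_order all_algebra.
From mathcomp Require Import fraction.
From mathcomp Require Import mpoly.

Set Implicit Arguments.
Unset Strict Implicit.
Unset Printing Implicit Defensive.

Import GRing.Theory.
Local Open Scope ring_scope.

(* Integer partitions: weakly decreasing sequences of positive integers.      *)
(* The part la_i (i >= 1) is nth 0 la i.-1, which is 0 beyond the length.     *)

Definition is_part (la : seq nat) : bool := sorted geq la && (0%N \notin la).

(* parts_le k n enumerates the partitions of n with all parts at most k, by   *)
(* the number j of parts equal to k.                                          *)
Fixpoint parts_le (k n : nat) : seq (seq nat) :=
  if k is k'.+1 then
    [seq nseq j k ++ s | j <- iota 0 (n %/ k).+1, s <- parts_le k' (n - j * k)]
  else if n == 0%N then [:: [::]] else [::].

Definition parts (n : nat) : seq (seq nat) := parts_le n n.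

Lemma mem_parts_le (k n : nat) (la : seq nat) :
  (la \in parts_le k n) =
  [&& is_part la, all (fun r => r <= k)%N la & sumn la == n].
Proof.
have geqT : transitive geq by move=> y x z /= xy yz; apply: leq_trans yz xy.
elim: k n la => [|k IH] n la.
  case: la => [|x s]; first by case: n.
  rewrite /= /is_part inE; case: x => [|x] /=; rewrite ?andbF //.
  - by case: n => [|n]; rewrite ?inE ?in_nil.
  - by case: n; rewrite ?in_nil.
apply/idP/idP.
  move=> /allpairsPdep[j [s [+ + ->]]].
  rewrite mem_iota /= add0n ltnS leq_divRL // => le_jn.
  rewrite IH /is_part !sorted_pairwise // => /and3P[/andP[srt s0] sk /eqP sum_s].
  rewrite pairwise_cat srt andbT mem_cat (negbTE s0) orbF all_cat sumn_cat sum_s.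
  rewrite sumn_nseq mulnC subnKC // eqxx andbT.
  have Ek : all (fun r => r <= k.+1)%N (nseq j k.+1) by rewrite all_nseq leqnn orbT.
  rewrite Ek /=; apply/andP; split; last by apply: sub_all sk => x; apply: leqW.
  rewrite mem_nseq andbF andbT; apply/andP; split.
    apply/allrelP => x y /nseqP[-> _] /(allP sk) /=; exact: leqW.
  by elim: (j) => //= i ->; rewrite all_nseq /= leqnn orbT.
move=> /and3P[Pla lek /eqP sum_la]; apply/allpairsPdep.
set j := count_mem k.+1 la; pose s := [seq x <- la | (x <= k)%N].
have Ela : la = nseq j k.+1 ++ s.
  rewrite /j /s {j s}; move: Pla lek => /andP[+ _].
  rewrite sorted_pairwise //; elim: la {sum_la} => //= x la IHla.
  move=> /andP[x_la pla] /andP[xk lek]; rewrite {1}(IHla pla lek).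
  case: leqP => [x_k|k_x]; last first.
    have -> : x = k.+1 by apply/eqP; rewrite eqn_leq xk k_x.
    by rewrite eqxx.
  rewrite (ltn_eqF (_ : x < k.+1)%N) // add0n.
  suff -> : count_mem k.+1 la = 0%N by [].
  apply/eqP; rewrite -leqn0 leqNgt -has_count; apply/hasPn => y /(allP x_la) /= yx.
  by rewrite neq_ltn ltnS (leq_trans yx x_k).
have sumE : n = (j * k.+1 + sumn s)%N.
  by rewrite -sum_la {1}Ela sumn_cat sumn_nseq mulnC.
exists j, s; split=> //.
  by rewrite mem_iota /= add0n ltnS leq_divRL // sumE leq_addr.
rewrite IH sumE addKn eqxx andbT filter_all andbT.
move: Pla => /andP[srt la0]; rewrite /is_part sorted_filter //=.
by apply: contra la0; rewrite mem_filter => /andP[].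
Qed.

Lemma mem_parts (n : nat) (la : seq nat) :
  (la \in parts n) = is_part la && (sumn la == n).
Proof.
rewrite mem_parts_le; congr (_ && _).
apply: andb_idl => /eqP <-; elim: la => //= x la IH.
by rewrite leq_addr; apply: sub_all IH => y /= /leq_trans-> //; apply: leq_addl.
Qed.

Lemma uniq_parts (n : nat) : uniq (parts n).
Proof.
rewrite /parts; move: {1}n => k.
elim: k n => [|k IH] m; first by rewrite /=; case: ifP.
apply: allpairs_uniq_dep => [|j _|]; [exact: iota_uniq | exact: IH |].
move=> _ _ /allpairsPdep[j [s [_ sj ->]]] /allpairsPdep[j' [s' [_ sj' ->]]] /= E.
have cnt i u p : u \in parts_le k p -> count_mem k.+1 (nseq i k.+1 ++ u) = i.
  rewrite mem_parts_le => /and3P[_ /allP uk _].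
  rewrite count_cat count_nseq /= eqxx mul1n.
  suff -> : count_mem k.+1 u = 0%N by rewrite addn0.
  apply/eqP; rewrite -leqn0 leqNgt -has_count; apply/hasPn => y /uk /= yk.
  by rewrite neq_ltn ltnS yk.
have Ej : j = j' by move: (cnt j s _ sj); rewrite E (cnt j' s' _ sj').
subst j'; congr Tagged.
by move/(congr1 (drop j)): E; rewrite !drop_size_cat ?size_nseq.
Qed.

Definition dominated (mu la : seq nat) : bool :=
  all (fun k => sumn (take k mu) <= sumn (take k la))%N (iota 0 (size mu).+1).

(* Symmetric functions. An element of Lambda is given by its image in n       *)
(* variables for every n; identities in Lambda are identities for all n.      *)

Definition symfun (R : comNzRingType) := forall n : nat, {mpoly R[n]}.

(* The bound on the degree only makes the index type of the sum finite.       *)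
Definition msymf (R : comNzRingType) (la : seq nat) : symfun R := fun n =>
  \sum_(m : 'X_{1..n < (sumn la).+1} |
          perm_eq [seq e <- (m : 'X_{1..n}) | (0 < e)%N] la) 'X_[m].

Definition psymf (R : comNzRingType) (la : seq nat) : symfun R := fun n =>
  \prod_(r <- la) \sum_(i < n) 'X_i ^+ r.

Definition expands_in (R : comNzRingType) (basis : seq nat -> symfun R)
    (d : nat) (f : symfun R) (c : seq nat -> R) : Prop :=
  forall n : nat, f n = \sum_(la <- parts d) c la *: basis la n.

(* The fields Q(q) and Q(q,t) = Q(q)(t).                                      *)

Definition Qq : fieldType := {fraction {poly rat}}.
Definition Qqt : fieldType := {fraction {poly Qq}}.

Definition q : Qq := @FracField.tofrac {poly rat} 'X.
Definition qt_q : Qqt := @FracField.tofrac {poly Qq} (q%:P).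
Definition qt_t : Qqt := @FracField.tofrac {poly Qq} 'X.

(* f in Q(q)(t) has no pole at t = 0, and its value there is c.               *)
Definition value_at_t0 (f : Qqt) (c : Qq) : Prop :=
  exists num den : {poly Qq},
    [/\ den.[0] != 0,
        f = @FracField.tofrac {poly Qq} num / @FracField.tofrac {poly Qq} den
      & c = num.[0] / den.[0]].

(* Macdonald polynomials P_la(x;q,t), as in Macdonald's book: unitriangular   *)
(* in the monomial basis for the dominance order, and pairwise orthogonal for *)
(* <p_la, p_mu> = delta_{la mu} z_la prod_i (1 - q^la_i) / (1 - t^la_i).      *)

Definition zpart (la : seq nat) : nat :=
  ((\prod_(r <- la) r) * \prod_(r <- undup la) (count_mem r la)`!)%N.

Definition zpart_qt (la : seq nat) : Qqt :=
  (zpart la)%:R * \prod_(r <- la) ((1 - qt_q ^+ r) / (1 - qt_t ^+ r)).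

(* <f, g>_{q,t} = v, for f and g homogeneous of degree d.                     *)
Definition scalar_qt (d : nat) (f g : symfun Qqt) (v : Qqt) : Prop :=
  exists c c' : seq nat -> Qqt,
    [/\ expands_in (@psymf Qqt) d f c, expands_in (@psymf Qqt) d g c'
      & v = \sum_(rho <- parts d) c rho * c' rho * zpart_qt rho].

(* Only partitions of equal size are tested for orthogonality: components of  *)
(* different degrees are orthogonal for <,>_{q,t}.                            *)
Definition is_macdonald (P : seq nat -> symfun Qqt) : Prop :=
  (forall la, is_part la ->
     exists u : seq nat -> Qqt,
       [/\ expands_in (@msymf Qqt) (sumn la) (P la) u, u la = 1
         & forall mu, is_part mu -> sumn mu = sumn la ->
             u mu != 0 -> dominated mu la]) /\
  (forall la mu, is_part la -> is_part mu -> sumn la = sumn mu -> la <> mu ->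
     scalar_qt (sumn la) (P la) (P mu) 0).

(* W_mu(x;q) = P_mu(x;q,0), coefficient by coefficient.                       *)
Definition is_qwhittaker (W : seq nat -> symfun Qq) : Prop :=
  exists P : seq nat -> symfun Qqt,
    is_macdonald P /\
    forall mu, is_part mu ->
      forall (n : nat) (m : 'X_{1..n}), value_at_t0 (P mu n)@_m (W mu n)@_m.

Definition qint (n : nat) : Qq := \sum_(i < n) q ^+ i.
Definition qfact (n : nat) : Qq := \prod_(i < n) qint i.+1.
Definition qmultinom (n : nat) (bs : seq nat) : Qq :=
  qfact n / \prod_(b <- bs) qfact b.

(* Tableaux. Rows, columns and entries are numbered from 0, so that the entry *)
(* i >= 1 is represented by i.-1; entries of a tableau of content nu are at   *)
(* most size nu.                                                              *)

Definition cell (mu : seq nat) : finType :=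
  {c : 'I_(size mu) * 'I_(head 0%N mu) | (c.2 < nth 0%N mu c.1)%N}.
Definition row_of (mu : seq nat) (c : cell mu) : 'I_(size mu) := (val c).1.
Definition col_of (mu : seq nat) (c : cell mu) : 'I_(head 0%N mu) := (val c).2.

Definition filling (mu nu : seq nat) : finType :=
  {ffun cell mu -> 'I_(size nu)}.

Definition SSYT (mu nu : seq nat) : {set filling mu nu} :=
  [set T : filling mu nu |
    [&& [forall c, forall c', (row_of c == row_of c') ==>
           (col_of c <= col_of c')%N ==> (T c <= T c')%N],
        [forall c, forall c', (col_of c == col_of c') ==>
           (row_of c < row_of c')%N ==> (T c < T c')%N]
      & [forall k, #|[set c | T c == k]| == nth 0%N nu k]]].

Definition r_cell (mu nu : seq nat) (T : filling mu nu) (c : cell mu) : nat :=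
  #|[set c' : cell mu | [&& (row_of c').+1 == row_of c :> nat,
                            (col_of c <= col_of c')%N & (T c' < T c)%N]]|.

Definition r_q (mu nu : seq nat) (T : filling mu nu) : Qq :=
  \prod_(c : cell mu | (0 < row_of c)%N) qint (r_cell T c).

Definition beta (mu nu : seq nat) (T : filling mu nu)
    (k : 'I_(size nu)) (j : 'I_(size mu)) : nat :=
  #|[set c : cell mu | (T c == k) && (row_of c == j)]|.

Definition s_q (mu nu : seq nat) (T : filling mu nu) : Qq :=
  \prod_(k < size nu)
     qmultinom (nth 0%N nu k) [seq beta T k j | j <- enum 'I_(size mu)].

Definition b_coef (mu nu : seq nat) : Qq :=
  \sum_(T in SSYT mu nu) r_q T * s_q T.

(* Main.v *)
Require Import Defs.
From mathcomp Require Import all_boot all_order all_algebra.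
From mathcomp Require Import fraction.
From mathcomp Require Import mpoly.
From mathcomp Require Import ring zify.

(* Idea. Let F_mu be the polynomials given by the branching rule with the     *)
(* coefficients psi. A one-variable skew Cauchy identity (q-Vandermonde in    *)
(* each row, then reflecting the summation index) gives the Pieri rule and    *)
(* the Cauchy identity for F_mu, whose kernel is also                         *)
(* sum_rho z_rho(q)^-1 p_rho(x) p_rho(y) with                                 *)
(* z_rho(q) = z_rho prod_i (1 - q^rho_i). Hence the F_mu are orthogonal for   *)
(* the scalar product <,>_{q,0}. They are unitriangular for the dominance     *)
(* order, and so are the W_mu, which are orthogonal for <,>_{q,0} by letting  *)
(* t = 0 in the definition of P_mu(x;q,t); uniqueness of the Gram-Schmidt     *)
(* basis gives W_mu = F_mu. Finally a tableau is the chain of the shapes of   *)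
(* its entries < k, and r_q(T) s_q(T) is, up to the factor in the theorem, a  *)
(* telescoping product times the product of psi along the chain.              *)

(** Write psi for the branching coefficients and F_mu for the polynomial whose coefficients [Acoef]
    are sums of products of psi over chains of horizontal strips. Two facts are combined: [W mu] has
    the coefficients [Acoef] ([qwhittaker_mcoeff]), and the tableau sum is the same chain sum up to
    an explicit factor ([sum_tableau_weights]).

    For the first, W_mu is known only by its characterization. Unitriangularity passes to t = 0, and
    so does orthogonality, because the passage between monomials and power sums is free of t. It
    remains to see that the F_mu are orthogonal. [Om_commute] says that adding a horizontal strip
    commutes with removing one, up to a factor depending only on sizes. [Pieri] and [Cauchy] follow
    by induction on the variables. [gd_power_sums] expands the Cauchy kernel in power sums, and
    comparing coefficients gives [gram_mx], an identity of two factorizations of one matrix. Its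
    inverse expresses the orthogonality of the F_mu, with nonzero norms. [unitriangular_orthogonal]
    then identifies the two families.

    For the second, a tableau is the chain of shapes of its entries below k. In a fixed row the
    cells with entry k have consecutive values of r_ij, so their q-integers multiply to a quotient
    of q-factorials ([r_weight_row]). With the q-multinomials this gives the weight of each strip
    ([tableau_weight]). The powers of 1 - q between (q;q)_n and [n]_q! telescope to (1 - q)^mu_1,
    which also occurs in [Bq mu] ([Bq_gfact]); the rest of [Bq mu] is the denominator in the
    theorem. *)

Set Implicit Arguments.
Unset Strict Implicit.
Unset Printing Implicit Defensive.

Import GRing.Theory.
Local Open Scope ring_scope.

(** * q-Vandermonde identities *)

Section QPochhammer.

Variables (K : fieldType) (z : K).
Hypothesis z_neq1 : forall n, 1 - z ^+ n.+1 != 0.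

Definition qpoch n : K := \prod_(i < n) (1 - z ^+ i.+1).

(* 1 / (q; q)_(a - b), read as 0 when a < b. *)
Definition ih (a b : nat) : K := if (b <= a)%N then (qpoch (a - b))^-1 else 0.

Lemma qpochS n : qpoch n.+1 = qpoch n * (1 - z ^+ n.+1).
Proof. by rewrite /qpoch big_ord_recr. Qed.

Lemma qpoch0 : qpoch 0 = 1.
Proof. by rewrite /qpoch big_ord0. Qed.

Lemma qpoch_neq0 n : qpoch n != 0.
Proof. by apply/prodf_neq0 => i _; apply: z_neq1. Qed.

Lemma ihnn n : ih n n = 1.
Proof. by rewrite /ih leqnn subnn qpoch0 invr1. Qed.

Lemma ih_gt a b : (a < b)%N -> ih a b = 0.
Proof. by rewrite /ih ltnNge => /negbTE ->. Qed.

Lemma ih_le a b : (b <= a)%N -> ih a b = (qpoch (a - b))^-1.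
Proof. by rewrite /ih => ->. Qed.

Lemma ih_neq0 a b : (ih a b != 0) = (b <= a)%N.
Proof. by rewrite /ih; case: ifP => _; rewrite ?invr_eq0 ?qpoch_neq0 ?eqxx. Qed.

Lemma ihSS a b : ih a.+1 b.+1 = ih a b.
Proof. by rewrite /ih ltnS subSS. Qed.

Lemma ihD a b c : ih (a + c) (b + c) = ih a b.
Proof. by rewrite /ih leq_add2r subnDr. Qed.

Lemma ihSl a b : (1 - z ^+ (a.+1 - b)) * ih a.+1 b = ih a b.
Proof.
rewrite /ih; case: (leqP b a) => [ba|ab].
  by rewrite leqW // subSn // qpochS invfM mulrC -mulrA mulVf ?mulr1.
by rewrite (eqP ab) expr0 subrr mul0r.
Qed.

Lemma ihSr a b : ih a b.+1 = (1 - z ^+ (a - b)) * ih a b.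
Proof.
rewrite -ihSl ihSS.
by congr ((1 - z ^+ _) * _); lia.
Qed.

(* Both forms of the q-Vandermonde identity below are cases of this one: the  *)
(* recursion assumed on phi is what Pascal's rule needs in the step on b.     *)
Lemma qVandermonde_gen (phi : nat -> nat -> K) (g : nat -> K) D a b :
  (a <= D)%N ->
  (forall b m, (m <= a)%N -> z ^+ (a - m) * phi b.+1 m
     + (1 - z ^+ (a - m)) * phi b.+1 m.+1 = g b * phi b m) ->
  \sum_(m < D.+1) z ^+ ((a - m) * (b - m)) * ih a m * ih b m * ih m 0 * phi b m
  = ih a 0 * ih b 0 * (\prod_(i < b) g i) * phi 0%N 0%N.
Proof.
move=> aD Hphi; elim: b => [|b IH].
  rewrite big_ord_recl big1 => [|i _]; last by rewrite (@ih_gt 0%N (lift ord0 i)) ?(mulr0, mul0r).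
  by rewrite muln0 expr0 ihnn big_ord0; ring.
have zb : 1 - z ^+ b.+1 != 0 by [].
apply: (mulfI zb); rewrite [\prod_(i < b.+1) _]big_ord_recr /=.
have -> : (1 - z ^+ b.+1) * (ih a 0 * ih b.+1 0 * (\prod_(i < b) g i * g b) * phi 0%N 0%N)
   = g b * (ih a 0 * ih b 0 * \prod_(i < b) g i * phi 0%N 0%N).
  by rewrite -(ihSl b 0) subn0; ring.
rewrite -IH !big_distrr /=.
(* Pascal's rule: [1 - z^(b+1)] is [(1 - z^(b+1-m)) + z^(b+1-m) (1 - z^m)]. The first part lowers
   [ih b.+1 m], the second lowers [ih m 0]. [T2] vanishes at 0 and at [D.+1], so it can be shifted
   by one and matched with [T1] through the recursion on [phi]. *)
pose T1 m := z ^+ ((a - m) * (b.+1 - m)) * ih a m * ih b m * ih m 0 * phi b.+1 m.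
pose T2 m := z ^+ ((a - m) * (b.+1 - m)) * z ^+ (b.+1 - m) * ih a m * ih b.+1 m
             * ((1 - z ^+ m) * ih m 0) * phi b.+1 m.
rewrite (eq_bigr (fun m : 'I_D.+1 => T1 m + T2 m)); last first.
  move=> m _; rewrite /T1 /T2 -(ihSl b m); case: (leqP m b.+1) => [mb|bm].
    by rewrite -[X in 1 - z ^+ X](subnK mb) exprD; ring.
  by rewrite (ih_gt bm); ring.
have T20 : T2 0%N = 0 by rewrite /T2 expr0 subrr !(mulr0, mul0r).
have T2D : T2 D.+1 = 0 by rewrite /T2 (ih_gt (a := a)) ?(mulr0, mul0r).
rewrite big_split /= [X in _ + X]big_ord_recl /= T20 add0r.
have -> : \sum_(i < D) T2 (bump 0 i) = \sum_(i < D.+1) T2 i.+1.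
  by rewrite [RHS]big_ord_recr /= T2D addr0.
rewrite -big_split /=; apply: eq_bigr => m _.
case: (leqP m a) => [ma|am]; last first.
  by rewrite /T1 /T2 (ih_gt am) (ih_gt (leqW am)) !(mulr0, mul0r, addr0).
case: (leqP m b) => [mb|bm]; last first.
  by rewrite /T1 /T2 ihSS (ih_gt bm) !(mulr0, mul0r, addr0).
have -> : g b * (z ^+ ((a - m) * (b - m)) * ih a m * ih b m * ih m 0 * phi b m)
  = z ^+ ((a - m) * (b - m)) * ih a m * ih b m * ih m 0 * (g b * phi b m) by ring.
rewrite -Hphi // /T1 /T2 subSS ihSS ihSr -[in (1 - _) * ih m.+1 0](subn0 m.+1) ihSl subSn //.
rewrite mulnSr exprD; case: (leqP a m) => [am|ma'].
  by rewrite (eqP am) expr0 subrr; ring.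
have -> : ((a - m) * (b - m) = (a - m.+1) * (b - m) + (b - m))%N by rewrite -mulSnr subnSK.
by rewrite exprD; ring.
Qed.

(** The terms with [m < p] vanish, and [ih] depends only on the difference of its arguments, so [m]
    can be replaced by [m + p]. *)
Lemma qVandermonde_shift D (F : nat -> nat -> K) k t p : (p <= k <= D)%N -> (p <= t)%N ->
  \sum_(m < D.+1) z ^+ ((k - m) * (t - m)) * ih k m * ih t m * ih m p * F t m =
  \sum_(m < D.+1) z ^+ ((k - p - m) * (t - p - m)) * ih (k - p) m * ih (t - p) m
      * ih m 0 * F t (m + p)%N.
Proof.
move=> /andP[pk kD] pt.
rewrite -(big_mkord xpredT (fun m => z ^+ ((k - m) * (t - m)) * ih k m * ih t m * ih m p * F t m)).
rewrite (big_cat_nat (n := p)) //=; last by lia.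
rewrite big_nat_cond big1 ?add0r => [|m /andP[/andP[_ mp] _]]; last by rewrite (ih_gt mp) mulr0 mul0r.
rewrite -{1}[p]add0n big_addn big_mkord.
have -> : (D.+1 = (D.+1 - p) + p)%N by lia.
rewrite [RHS]big_split_ord /= [X in _ = _ + X]big1 ?addr0 => [|m _]; last first.
  by rewrite (@ih_gt (k - p)) ?(mulr0, mul0r) //=; lia.
rewrite addnK; apply: eq_bigr => m _.
have <- : ih (m + p) p = ih m 0 by rewrite -(ihD m 0 p).
have <- : (k - (m + p) = k - p - m)%N by lia.
have <- : (t - (m + p) = t - p - m)%N by lia.
case: (leqP (m + p) k) => [mk|km]; last by rewrite (ih_gt km) (@ih_gt (k - p)) ?(mulr0,mul0r) //; lia.
case: (leqP (m + p) t) => [mt|tm]; last first.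
  by rewrite (ih_gt tm) (@ih_gt (t - p)) ?(mulr0, mul0r) //; lia.
by rewrite -(ihD (k - p) m p) -(ihD (t - p) m p) !subnK //; lia.
Qed.

(** Formally the limit of [qVandermonde] for large [l], where [ih (l + m) (k + t)] tends to a
    constant. *)
Lemma qVandermonde_lim D k t p : (k <= D)%N ->
  \sum_(m < D.+1) z ^+ ((k - m) * (t - m)) * ih k m * ih t m * ih m p
  = ih k p * ih t p.
Proof.
move=> kD; case: (leqP p k) => [pk|kp]; last first.
  rewrite (ih_gt kp) mul0r big1 // => m _.
  case: (leqP m k) => mk; last by rewrite (ih_gt mk) !(mulr0, mul0r).
  by rewrite (ih_gt (leq_ltn_trans mk kp)) mulr0.
case: (leqP p t) => [pt|tp]; last first.
  rewrite (ih_gt tp) mulr0 big1 // => m _.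
  case: (leqP m t) => mt; last by rewrite (ih_gt mt) !(mulr0, mul0r).
  by rewrite (ih_gt (leq_ltn_trans mt tp)) mulr0.
under eq_bigr => m _ do rewrite -[_ * ih m p]mulr1.
rewrite (@qVandermonde_shift D (fun _ _ => 1)) ?pk //.
rewrite (@qVandermonde_gen (fun _ _ => 1) (fun _ => 1)); last 2 first.
- by lia.
- by move=> b m _; ring.
by rewrite big1 // !mulr1 -{2}(subnK pk) -{2}(subnK pt) -[p in RHS]add0n !ihD.
Qed.

(** The q-Chu-Vandermonde sum, used from right to left: on the left [l] and [p] occur in separate
    factors, linked only through [m]. *)
Lemma qVandermonde D l k t p : (k <= D)%N ->
  \sum_(m < D.+1) z ^+ ((k - m) * (t - m)) * ih k m * ih t m * ih m p
      * ih (l + m) (k + t)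
  = qpoch (l - p) * ih l k * ih l t * ih k p * ih t p.
Proof.
move=> kD; case: (leqP p k) => [pk|kp]; last first.
  rewrite (ih_gt kp) mulr0 mul0r big1 // => m _.
  case: (leqP m k) => mk; last by rewrite (ih_gt mk) !(mulr0, mul0r).
  by rewrite (ih_gt (leq_ltn_trans mk kp)) mulr0 mul0r.
case: (leqP p t) => [pt|tp]; last first.
  rewrite (ih_gt tp) mulr0 big1 // => m _.
  case: (leqP m t) => mt; last by rewrite (ih_gt mt) !(mulr0, mul0r).
  by rewrite (ih_gt (leq_ltn_trans mt tp)) mulr0 mul0r.
case: (leqP k l) => [kl|lk]; last first.
  rewrite (ih_gt lk) mulr0 !mul0r big1 // => m _.
  case: (leqP m t) => mt; last by rewrite (ih_gt mt) !(mulr0, mul0r).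
  by rewrite (@ih_gt (l + m)) ?mulr0 //; lia.
rewrite (@qVandermonde_shift D (fun t m => ih (l + m) (k + t))) ?pk //.
set a := (k - p)%N; set b := (t - p)%N; pose N := (l - p)%N.
pose phi b m := ih (N + m) (a + b).
have -> : \sum_(m < D.+1) z ^+ ((a - m) * (b - m)) * ih a m * ih b m * ih m 0
     * ih (l + (m + p)) (k + t)
  = \sum_(m < D.+1) z ^+ ((a - m) * (b - m)) * ih a m * ih b m * ih m 0 * phi b m.
  apply: eq_bigr => m _; congr (_ * _); rewrite /phi -(ihD (N + m) _ (p + p)).
  by congr ih; lia.
rewrite (@qVandermonde_gen phi (fun b => 1 - z ^+ (N - b))); last 2 first.
- by lia.
- move=> {}b m ma; rewrite /phi !addnS ihSS.
  case: (leqP (a + b) (N + m)) => h; last by rewrite (ih_gt h) (ih_gt (leqW h)); ring.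
  rewrite ihSr; case: (leqP b N) => bN.
    have -> : (N - b = (a - m) + (N + m - (a + b)))%N by lia.
    by rewrite exprD; ring.
  by lia.
have Nb : qpoch N * ih N b = \prod_(i < b) (1 - z ^+ (N - i)).
  elim: (b) => [|c IH]; first by rewrite big_ord0 ih_le // subn0 mulfV ?qpoch_neq0.
  by rewrite big_ord_recr /= -IH ihSr; ring.
rewrite -Nb /phi !addn0.
rewrite -(ihD a 0 p) -(ihD b 0 p) -(ihD N a p) -(ihD N b p) add0n !subnK //; last by lia.
ring.
Qed.
End QPochhammer.

(** * Interlacing partitions and the skew Cauchy identity *)

Section Interlacing.

Variables (K : fieldType) (z : K).
Hypothesis z_neq1 : forall n, 1 - z ^+ n.+1 != 0.
Local Notation qpoch := (qpoch z).
Local Notation ih := (ih z).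

(* Partitions with at most L parts, all at most D, padded with zeros to length *)
(* L; vecs D L also contains the lists that are not weakly decreasing.         *)
Fixpoint vecs (D L : nat) : seq (seq nat) :=
  if L is L'.+1 then [seq a :: v | a <- iota 0 D.+1, v <- vecs D L']
  else [:: [::]].

Lemma mem_vecs D L v : (v \in vecs D L) = (size v == L) && all (leq^~ D) v.
Proof.
elim: L v => [|L IH] v; first by case: v.
apply/allpairsP/idP => [[[a u] []]|].
  by rewrite mem_iota IH => aD /andP[su uD] ->; rewrite /= eqSS su uD andbT.
case: v => //= a v; rewrite eqSS => /and3P[sv aD vD].
have aiD : a \in iota 0 D.+1 by rewrite mem_iota.
by exists (a, v); split=> //; rewrite IH sv.
Qed.

Lemma uniq_vecs D L : uniq (vecs D L).
Proof.
elim: L => // L IH; apply: allpairs_uniq; [exact: iota_uniq | exact: IH |].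
by move=> [a u] [b v] _ _ /= [-> ->].
Qed.

Lemma size_vecs D L v : v \in vecs D L -> size v = L.
Proof. by rewrite mem_vecs => /andP[/eqP]. Qed.

Lemma big_vecsS (V : nmodType) D L (F : seq nat -> V) (P : pred (seq nat)) :
  \sum_(v <- vecs D L.+1 | P v) F v =
  \sum_(a < D.+1) \sum_(v <- vecs D L | P (nat_of_ord a :: v)) F (nat_of_ord a :: v).
Proof.
rewrite [LHS]big_mkcond big_allpairs_dep -[iota 0 D.+1]/(index_iota 0 D.+1) big_mkord.
by apply: eq_bigr => a _; rewrite [RHS]big_mkcond.
Qed.

Lemma big_vecs_rcons (V : nmodType) D L (F : seq nat -> V) :
  \sum_(v <- vecs D L.+1) F v =
  \sum_(v <- vecs D L) \sum_(a < D.+1) F (rcons v a).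
Proof.
elim: L F => [|L IH] F.
  by rewrite big_vecsS big_seq1; apply: eq_bigr => a _; rewrite big_seq1.
rewrite big_vecsS [RHS]big_vecsS; apply: eq_bigr => a _.
by rewrite (IH (fun v => F (nat_of_ord a :: v))).
Qed.

(* The coefficient psi_(la / ka) is Bq la * Om la ka; Om la ka vanishes unless *)
(* la / ka is a horizontal strip of partitions.                                *)
Fixpoint Om (la ka : seq nat) : K :=
  match la, ka with
  | a :: la', b :: ka' => ih a b * ih b (head 0%N la') * Om la' ka'
  | _, _ => 1
  end.

Fixpoint Bq (la : seq nat) : K :=
  if la is a :: la' then qpoch (a - head 0%N la') * Bq la' else 1.

Definition dOm (la ka ta : seq nat) : K := Bq la * Om la ka * Om la ta.

(** On the support [c - m' <= l <= m], replacing [l] by [m + c - m' - l] exchanges the two factors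
    [ih]; only [E] is affected. *)
Lemma sum_reflect D m m' c (E E' : nat -> K) : (m <= D)%N -> (m' <= c)%N ->
  (forall l l', l + l' + m' = m + c -> E l = E' l')%N ->
  \sum_(l < D.+1) ih m l * ih (l + m') c * E l =
  \sum_(l < D.+1) ih m l * ih (l + m') c * E' l.
Proof.
move=> mD mc HE.
suff trunc (G : nat -> K) : \sum_(l < D.+1) ih m l * ih (l + m') c * G l =
    \sum_(c - m' <= l < m.+1) ih m l * ih (l + m') c * G l.
  rewrite !trunc big_nat_rev /=; apply: eq_big_nat => l /andP[lc lm].
  set j := (X in ih m X); have jE : (j + l + m' = m + c)%N by rewrite /j; lia.
  rewrite (HE j l) //; congr (_ * _).
  have -> : ih m j = ih (l + m') c.
    by rewrite -(ihD _ m j (l + m')) -[RHS](ihD _ _ _ m); congr ih; lia.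
  have -> : ih (j + m') c = ih m l.
    by rewrite -(ihD _ _ c l) -[RHS](ihD _ _ _ c); congr ih; lia.
  exact: mulrC.
rewrite -(big_mkord xpredT (fun l => ih m l * ih (l + m') c * G l)).
rewrite (big_cat_nat (n := m.+1)) //= [X in _ + X]big_nat_cond [X in _ + X]big1 ?addr0; last first.
  by move=> l /andP[/andP[ml _] _]; rewrite ih_gt // !mul0r.
case: (leqP (c - m') m.+1) => [cm|mc'].
  rewrite (big_cat_nat (n := (c - m')%N)) //= big_nat_cond big1 ?add0r //.
  by move=> l /andP[/andP[_ lc] _]; rewrite (@ih_gt _ _ (l + m')) ?(mulr0, mul0r) //; lia.
rewrite [RHS]big_geq; last by lia.
rewrite big_nat_cond big1 // => l /andP[/andP[_ lm] _].
by rewrite (@ih_gt _ _ (l + m')) ?(mulr0, mul0r) //; lia.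
Qed.

(** [qVandermonde] with [p] the next row [head 0 v]: the first row [l] and the other rows [v] then
    interact only through [m]. *)
Lemma dOm_cons D l v k t ka ta : (k <= D)%N ->
  dOm (l :: v) (k :: ka) (t :: ta) =
  (\sum_(m < D.+1) z ^+ ((k - m) * (t - m)) * ih k m * ih t m
     * ih m (head 0%N v) * ih (l + m) (k + t)) * dOm v ka ta.
Proof. by move=> kD; rewrite qVandermonde //= /dOm /=; ring. Qed.

(* The sums over all partitions interlacing both ka and ta are invariant under *)
(* a reflection of the total size, row by row after q-Vandermonde.             *)
Lemma dOm_reflect D ka ta m (f f' : nat -> K) : size ka = size ta ->
  all (leq^~ D) ka -> (m <= D)%N -> last m ka = 0%N -> last m ta = 0%N ->
  (forall s s', s + s' = m + (sumn ka + sumn ta) -> f s = f' s')%N ->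
  \sum_(v <- vecs D (size ka)) ih m (head 0%N v) * dOm v ka ta * f (sumn v) =
  \sum_(v <- vecs D (size ka)) ih m (head 0%N v) * dOm v ka ta * f' (sumn v).
Proof.
elim: ka ta m f f' => [|k ka IH] [|t ta] //= m f f' => [_ _ _ m0 _ Hf|].
  by rewrite !big_seq1 /= (Hf 0%N 0%N) ?m0.
move=> [sz] /andP[kD kaD] mD lk lt Hf.
pose w m2 := z ^+ ((k - m2) * (t - m2)) * ih k m2 * ih t m2.
pose E (g : nat -> K) m2 l :=
  \sum_(v <- vecs D (size ka)) ih m2 (head 0%N v) * dOm v ka ta * g (l + sumn v)%N.
have expand g : \sum_(v <- vecs D (size ka).+1) ih m (head 0%N v)
      * dOm v (k :: ka) (t :: ta) * g (sumn v) =
    \sum_(m2 < D.+1) w m2 * \sum_(l < D.+1) ih m l * ih (l + m2) (k + t) * E g m2 l.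
  rewrite big_vecsS; under [RHS]eq_bigr => m2 _ do rewrite big_distrr /=.
  rewrite [RHS]exchange_big; apply: eq_bigr => l _ /=.
  under [RHS]eq_bigr => m2 _ do rewrite /E !big_distrr /=.
  rewrite [RHS]exchange_big; apply: eq_bigr => v _ /=.
  rewrite (dOm_cons _ _ _ _ _ kD) mulrC !big_distrl !big_distrr /=.
  by apply: eq_bigr => m2 _; rewrite /w; ring.
rewrite !expand; apply: eq_bigr => m2 _; rewrite /w.
case: (leqP m2 k) => m2k; last by rewrite (ih_gt _ m2k) !(mulr0, mul0r).
case: (leqP m2 t) => m2t; last by rewrite (ih_gt _ m2t) !(mulr0, mul0r).
(* The first row is reflected by [sum_reflect], the others by induction with [m2] in the place of
   [m]; the two reflections add up to that of the total size. *)
congr (_ * _); apply: sum_reflect => //; first by lia.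
move=> l l' ll'.
apply: (IH ta m2 (fun s => f (l + s)%N) (fun s => f' (l' + s)%N)) => //; first by lia.
- by move: lk m2k; case: (ka) => //= ->; rewrite leqn0 => /eqP.
- by move: lt m2t; case: (ta) => //= ->; rewrite leqn0 => /eqP.
by move=> s s' ss'; apply: Hf; lia.
Qed.

Lemma Om_cons a b la ka :
  Om (a :: la) (b :: ka) = ih a b * ih b (head 0%N la) * Om la ka.
Proof. by []. Qed.

(** The inequalities k >= v_1 >= ka_1 >= v_2 >= ... place [v] below [k :: ka] as well as above [ka].
    This is how a sum over larger shapes becomes one over smaller shapes. *)
Lemma Om_rcons0 k ka v : size v = size ka ->
  Om (k :: ka) (rcons v 0%N) = ih k (head 0%N v) * Om v ka.
Proof.
elim: ka k v => [|k' ka IH] k [|m v] // => [_|[sz]].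
  by rewrite /= ihnn; ring.
by rewrite rcons_cons !Om_cons IH //=; ring.
Qed.

Lemma Om_rconsS k ka v a : size v = size ka -> last k ka = 0%N -> (0 < a)%N ->
  Om (k :: ka) (rcons v a) = 0.
Proof.
elim: ka k v => [|k' ka IH] k [|m v] // => [_ lk a0|[sz] lk a0].
  by rewrite Om_cons [k]lk ih_gt // !mul0r.
by rewrite rcons_cons Om_cons IH // mulr0.
Qed.

Lemma Bq_rcons0 v : Bq (rcons v 0%N) = Bq v.
Proof.
elim: v => [|a [|b v] IH]; rewrite /= ?subn0 ?qpoch0 ?mulr1 //.
by congr (_ * _); exact: IH.
Qed.

(* The one-variable skew Cauchy identity. *)
Lemma Om_commute D N k t ka ta : size ka = size ta ->
  all (leq^~ D) (k :: ka) -> (N <= D)%N ->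
  last k ka = 0%N -> last t ta = 0%N ->
  \sum_(la <- vecs D (size ka).+1 | sumn la == N) dOm la (k :: ka) (t :: ta) =
  \sum_(mu <- vecs D (size ka).+1)
     ih (sumn mu + N) (sumn (k :: ka) + sumn (t :: ta))
     * (Bq mu * Om (k :: ka) mu * Om (t :: ta) mu).
Proof.
move=> sz /andP[kD kaD] ND lk lt.
pose w m := z ^+ ((k - m) * (t - m)) * ih k m * ih t m.
pose f m s := \sum_(l < D.+1 | (l + s == N)%N) ih (l + m) (k + t).
pose f' s := ih (s + N) (sumn (k :: ka) + sumn (t :: ta)).
(* The first row of [la] is determined by the total size [N]; [f m s] is all that is left of it when
   the other rows have size [s]. *)
transitivity (\sum_(m < D.+1) w m *
    \sum_(v <- vecs D (size ka)) ih m (head 0%N v) * dOm v ka ta * f m (sumn v)).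
  rewrite big_vecsS /= (exchange_big_dep xpredT) //=.
  under [RHS]eq_bigr => m _ do rewrite big_distrr /=.
  rewrite [RHS]exchange_big; apply: eq_bigr => v _ /=.
  under eq_bigr => l _ do rewrite (dOm_cons _ _ _ _ _ kD) big_distrl /=.
  rewrite exchange_big; apply: eq_bigr => m _ /=.
  by rewrite /f !big_distrr /=; apply: eq_bigr => l _; rewrite /w; ring.
(* Reflecting [s] to [m + |ka| + |ta| - s] (sizes without the first rows) turns [f m] into [f'],
   which does not depend on [m]. *)
transitivity (\sum_(m < D.+1) w m *
    \sum_(v <- vecs D (size ka)) ih m (head 0%N v) * dOm v ka ta * f' (sumn v)).
  apply: eq_bigr => m _; rewrite /w.
  case: (leqP m k) => mk; last by rewrite (ih_gt _ mk) !(mulr0, mul0r).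
  case: (leqP m t) => mt; last by rewrite (ih_gt _ mt) !(mulr0, mul0r).
  congr (_ * _); apply: dOm_reflect => //; first by lia.
  - by move: lk mk; case: (ka) => //= ->; rewrite leqn0 => /eqP.
  - by move: lt mt; case: (ta) => //= ->; rewrite leqn0 => /eqP.
  move=> s s' ss'; rewrite /f /f'; case: (leqP s N) => sN; last first.
    rewrite big1 => [|l /eqP]; last by lia.
    by rewrite ih_gt //=; lia.
  have NsD : (N - s < D.+1)%N by lia.
  rewrite (big_pred1 (Ordinal NsD)) /=; last first.
    move=> l /=; apply/eqP/eqP => [ls|-> /=]; last by lia.
    by apply/val_inj => /=; lia.
  rewrite -(ihD _ _ _ (sumn ka + sumn ta)); congr ih; lia.
rewrite big_vecs_rcons; under eq_bigr => m _ do rewrite big_distrr /=.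
rewrite exchange_big big_seq [RHS]big_seq; apply: eq_bigr => v /size_vecs sv.
rewrite [RHS]big_ord_recl [X in _ = _ + X]big1 ?addr0 => [|a _]; last by rewrite Om_rconsS // !(mulr0, mul0r).
rewrite [nat_of_ord ord0]/= !Om_rcons0 -?sz // Bq_rcons0 sumn_rcons addn0.
(* The sum over [m] now stands alone, and [qVandermonde_lim] evaluates it to the factors that place
   [v] below the first rows [k] and [t]. *)
transitivity ((\sum_(m < D.+1) w m * ih m (head 0%N v)) * dOm v ka ta * f' (sumn v)).
  by rewrite !big_distrl; apply: eq_bigr => m _ /=; ring.
by rewrite qVandermonde_lim // /dOm /f' /=; ring.
Qed.

End Interlacing.

Arguments vecs : simpl never.

(** * Pieri rule and Cauchy identity *)

Lemma sumn_eq0 v : sumn v = 0%N -> v = nseq (size v) 0%N.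
Proof. by elim: v => //= a v IH /eqP; rewrite addn_eq0 => /andP[/eqP-> /eqP/IH <-]. Qed.

Lemma sumn_nseq0 n : sumn (nseq n 0%N) = 0%N.
Proof. by rewrite sumn_nseq mul0n. Qed.

Lemma sorted_last0 v : sorted geq v -> (sumn v < size v)%N -> last 0%N v = 0%N.
Proof.
case: v => //= a v; elim: v a => [|b v IH] a /=; first by case: a.
move=> /andP[ba bv] lt; have [a0|a0] := posnP a; last by apply: IH => //; lia.
move: ba bv {lt}; rewrite a0 leqn0 => /eqP -> {IH}.
by elim: v => //= c v IH; rewrite leqn0 => /andP[/eqP ->].
Qed.

Lemma big_antidiag (V : nmodType) d (F : nat -> nat -> V) :
  \sum_(k < d.+1) \sum_(j < (d - k).+1) F k j =
  \sum_(i < d.+1) \sum_(k < i.+1) F k (i - k)%N.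
Proof.
elim: d => [|d IH]; first by rewrite !big_ord1.
rewrite big_ord_recr [RHS]big_ord_recr /= -IH subnn big_ord1.
rewrite [X in _ = _ + X]big_ord_recr /= subnn [RHS]addrA; congr (_ + _).
rewrite -big_split; apply: eq_bigr => k _ /=; have kd := ltn_ord k.
by rewrite subSn // big_ord_recr.
Qed.

Section Branching.

Variables (K : fieldType) (z : K).
Hypothesis z_neq1 : forall n, 1 - z ^+ n.+1 != 0.
Local Notation qpoch := (qpoch z).
Local Notation ih := (ih z).
Local Notation Om := (Om z).
Local Notation Bq := (Bq z).

Lemma Om_neq0_nth la ka : size la = size ka -> Om la ka != 0 ->
  forall i, (nth 0 ka i <= nth 0 la i)%N /\ (nth 0 la i.+1 <= nth 0 ka i)%N.
Proof.
elim: la ka => [|a la IH] [|b ka] //= [sz].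
rewrite !mulf_eq0 !negb_or !ih_neq0 // => /andP[/andP[ba lab] omn] [|i] /=.
  by rewrite nth0.
exact: IH.
Qed.

Lemma Om_neq0_sumn la ka : size la = size ka -> Om la ka != 0 ->
  (sumn ka <= sumn la)%N.
Proof.
elim: la ka => [|a la IH] [|b ka] //= [sz].
rewrite !mulf_eq0 !negb_or !ih_neq0 // => /andP[/andP[ba _] omn].
exact: leq_add ba (IH _ sz omn).
Qed.

Lemma Om_neq0_sorted la ka : size la = size ka -> Om la ka != 0 ->
  sorted geq la /\ sorted geq ka.
Proof.
move=> sz /(Om_neq0_nth sz) Hi; split; apply/(sortedP 0%N) => i _ /=.
  by have [_ h] := Hi i; apply: leq_trans h (proj1 (Hi i)).
by have [_ h] := Hi i; apply: leq_trans (proj1 (Hi i.+1)) h.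
Qed.

Lemma Om_nseq0 L : Om (nseq L 0%N) (nseq L 0%N) = 1.
Proof.
elim: L => //= L ->; rewrite (_ : head 0%N _ = 0%N) ?ihnn ?mulr1 //.
by case: L.
Qed.

Lemma Bq_nseq0 L : Bq (nseq L 0%N) = 1.
Proof. by elim: L => //= L ->; rewrite sub0n qpoch0 mulr1. Qed.

Lemma big_vecs_sumn0 (V : nmodType) D L (F : seq nat -> V) :
  \sum_(v <- vecs D L | sumn v == 0%N) F v = F (nseq L 0%N).
Proof.
have nL : nseq L 0%N \in vecs D L by rewrite mem_vecs size_nseq eqxx all_nseq orbT.
rewrite big_mkcond (bigD1_seq _ nL (uniq_vecs _ _)) /= sumn_nseq0 eqxx.
rewrite big_seq_cond big1 ?addr0 // => v /andP[/size_vecs sv nv].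
by case: eqP => // /sumn_eq0 ev; case/eqP: nv; rewrite ev sv.
Qed.

(** With [D.+1] rows and size at most [D] the last row is 0, as [Om_commute] requires. If [ka] is
    not weakly decreasing or is larger than [N], both sides vanish. *)
Lemma Om_commute_gen D N ka ta : ka \in vecs D D.+1 -> ta \in vecs D D.+1 ->
  (N <= D)%N -> (sumn ta <= N)%N -> sorted geq ta ->
  \sum_(la <- vecs D D.+1 | sumn la == N) Bq la * Om la ka * Om la ta =
  \sum_(mu <- vecs D D.+1)
     ih (sumn mu + N) (sumn ka + sumn ta) * (Bq mu * Om ka mu * Om ta mu).
Proof.
move=> kv tv ND tN srt; have [sk st] := (size_vecs kv, size_vecs tv).
have [/andP[srk kN]|] := boolP (sorted geq ka && (sumn ka <= N)%N).
  have : last 0%N ka = 0%N by apply: sorted_last0; rewrite ?sk; lia.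
  have : last 0%N ta = 0%N by apply: sorted_last0; rewrite ?st; lia.
  have : all (leq^~ D) ka by move: kv; rewrite mem_vecs => /andP[].
  case: ka sk {kv srk kN} => // k ka; case: ta st {tv tN srt} => // t ta [st] [sk] kD lt lk.
  by have := @Om_commute _ _ z_neq1 D N k t ka ta; rewrite /dOm sk st => ->.
move=> nk; rewrite [RHS]big_seq [RHS]big1 => [|la /size_vecs sl]; last first.
  have [->|om] := eqVneq (Om ka la) 0; first by rewrite mulr0 mul0r mulr0.
  have [->|om'] := eqVneq (Om ta la) 0; first by rewrite !mulr0.
  rewrite ih_gt ?mul0r //.
  have [srk _] := Om_neq0_sorted (etrans sk (esym sl)) om.
  have := Om_neq0_sumn (etrans st (esym sl)) om'.
  by move: nk; rewrite srk /=; lia.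
rewrite big_seq_cond big1 // => la /andP[/size_vecs sl /eqP lN].
have [->|om] := eqVneq (Om la ka) 0; first by rewrite mulr0 mul0r.
have [_ srk] := Om_neq0_sorted (etrans sl (esym sk)) om.
have := Om_neq0_sumn (etrans sl (esym sk)) om.
by move: nk; rewrite srk /=; lia.
Qed.

Variables (S : comNzRingType) (f : {rmorphism K -> S}).

(* The symmetric function g_d(X; q, 0). *)
Fixpoint gd (d : nat) (X : seq S) : S :=
  if X is x :: X' then
    \sum_(k < d.+1) f (qpoch k)^-1 * x ^+ k * gd (d - k) X'
  else (d == 0%N)%:R.

(* Fh D mu X is the q-Whittaker polynomial of mu in the variables X, divided   *)
(* by Bq mu.                                                                   *)
Fixpoint Fh (D : nat) (mu : seq nat) (X : seq S) : S :=
  if X is x :: X' then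
    \sum_(ka <- vecs D (size mu))
       f (Om mu ka * Bq ka) * x ^+ (sumn mu - sumn ka) * Fh D ka X'
  else (sumn mu == 0%N)%:R.

Lemma Fh_nsorted D mu X : ~~ sorted geq mu -> Fh D mu X = 0.
Proof.
case: X => [|x X] ns /=.
  case: eqP => // /sumn_eq0 mu0; case/negP: ns; rewrite mu0.
  by apply/(sortedP 0%N) => i _; rewrite !nth_nseq !if_same.
rewrite big_seq big1 // => ka /size_vecs sk.
have [->|om] := eqVneq (Om mu ka) 0; first by rewrite mul0r rmorph0 !mul0r.
by case/negP: ns; have [] := Om_neq0_sorted (esym sk) om.
Qed.

Lemma Fh_nseq0 D L X : Fh D (nseq L 0%N) X = 1.
Proof.
elim: X => [|x X IH] /=; first by rewrite sumn_nseq0.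
rewrite size_nseq (bigID (fun ka => sumn ka == 0%N)) /= big_vecs_sumn0 Om_nseq0 Bq_nseq0.
rewrite mulr1 rmorph1 IH subnn !mulr1 big_seq_cond big1 ?addr0 // => ka.
move=> /andP[/size_vecs sk k0].
have [->|om] := eqVneq (Om (nseq L 0%N) ka) 0; first by rewrite mul0r rmorph0 !mul0r.
have := Om_neq0_sumn _ om; rewrite sumn_nseq0 size_nseq sk => /(_ erefl).
by rewrite leqn0 (negbTE k0).
Qed.

(** Induction on the variables. A strip is added to [ta] to reach [mu], and branching off [x]
    removes one to reach [ka]. [Om_commute_gen] exchanges the two moves: from [ta] down to [si],
    then up to [ka]. The factor [ih] so produced is the coefficient of a power of [x] in [gd]. *)
Lemma Pieri D ta s X : ta \in vecs D D.+1 -> (sumn ta + s <= D)%N ->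
  \sum_(mu <- vecs D D.+1 | sumn mu == (sumn ta + s)%N)
     f (Bq mu * Om mu ta) * Fh D mu X = gd s X * Fh D ta X.
Proof.
elim: X ta s => [|x X IH] ta s tv tsD.
  rewrite [gd _ _]/= [Fh _ ta _]/=; have [ts0|ts] := eqVneq (sumn ta + s)%N 0%N.
    have [/eqP -> ->] : (sumn ta == 0 /\ s = 0)%N by lia.
    rewrite big_vecs_sumn0 Fh_nseq0 !mulr1 -[ta](_ : nseq D.+1 0%N = ta).
      by rewrite Bq_nseq0 Om_nseq0 mulr1 rmorph1.
    by rewrite -(size_vecs tv); apply/esym/sumn_eq0; lia.
  rewrite big1 => [|mu /eqP /= ->]; last by rewrite (negbTE ts) mulr0.
  by move: ts; rewrite addn_eq0 negb_and => /orP[/negbTE ->|/negbTE ->]; rewrite ?mulr0 ?mul0r.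
have [srt|nsrt] := boolP (sorted geq ta); last first.
  rewrite (Fh_nsorted _ _ nsrt) mulr0 big_seq_cond big1 // => mu /andP[/size_vecs sm _].
  have [->|om] := eqVneq (Om mu ta) 0; first by rewrite mulr0 rmorph0 !mul0r.
  case/negP: nsrt.
  by have [] := Om_neq0_sorted (etrans sm (esym (size_vecs tv))) om.
set N := (sumn ta + s)%N.
transitivity (\sum_(ka <- vecs D D.+1) \sum_(si <- vecs D D.+1)
    f (ih (sumn si + N) (sumn ka + sumn ta) * (Bq si * Om ka si * Om ta si))
    * (f (Bq ka) * x ^+ (N - sumn ka) * Fh D ka X)).
  transitivity (\sum_(ka <- vecs D D.+1)
      f (\sum_(mu <- vecs D D.+1 | sumn mu == N) Bq mu * Om mu ka * Om mu ta)
      * (f (Bq ka) * x ^+ (N - sumn ka) * Fh D ka X)).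
    under [RHS]eq_bigr => ka _ do rewrite rmorph_sum big_distrl /=.
    rewrite [RHS]exchange_big /= big_seq_cond [RHS]big_seq_cond.
    apply: eq_bigr => mu /andP[/size_vecs sm /eqP muN].
    rewrite big_distrr /= sm muN; apply: eq_bigr => ka _.
    by rewrite !rmorphM; ring.
  rewrite big_seq [RHS]big_seq; apply: eq_bigr => ka kv.
  by rewrite Om_commute_gen ?leq_addr // rmorph_sum big_distrl.
rewrite exchange_big /= (size_vecs tv) [RHS]big_distrr /= big_seq [RHS]big_seq.
apply: eq_bigr => si sv.
have [->|om] := eqVneq (Om ta si) 0.
  rewrite mul0r rmorph0 !(mul0r, mulr0) big1 // => ka _.
  by rewrite !mulr0 rmorph0 mul0r.
have sit := Om_neq0_sumn (etrans (size_vecs tv) (esym (size_vecs sv))) om.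
transitivity (\sum_(k < s.+1) \sum_(ka <- vecs D D.+1 | sumn ka == (sumn si + (s - k))%N)
   f (qpoch k)^-1 * x ^+ k * (f (Om ta si * Bq si) * x ^+ (sumn ta - sumn si)) *
   (f (Bq ka * Om ka si) * Fh D ka X)); last first.
  rewrite big_distrl; apply: eq_bigr => k _ /=.
  rewrite -big_distrr /= (IH si) //; last by lia.
  ring.
rewrite (exchange_big_dep xpredT) //= big_seq [RHS]big_seq; apply: eq_bigr => ka kv.
have [->|om'] := eqVneq (Om ka si) 0.
  rewrite !(mulr0, mul0r) rmorph0 mul0r big1 // => k _.
  by rewrite mul0r mulr0.
have sik := Om_neq0_sumn (etrans (size_vecs kv) (esym (size_vecs sv))) om'.
case: (leqP (sumn ka) (sumn si + s)) => kas; last first.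
  rewrite ih_gt ?mul0r ?rmorph0 ?mul0r; last by rewrite /N; lia.
  by rewrite big1 // => k /eqP; lia.
have ks : (sumn si + s - sumn ka < s.+1)%N by lia.
rewrite (big_pred1 (Ordinal ks)) /=; last first.
  move=> k /=; apply/eqP/eqP => [h|-> /=]; last by lia.
  by apply/val_inj => /=; have := ltn_ord k; lia.
rewrite ih_le; last by rewrite /N; lia.
have -> : (sumn si + N - (sumn ka + sumn ta) = sumn si + s - sumn ka)%N by rewrite /N; lia.
have -> : (N - sumn ka = (sumn si + s - sumn ka) + (sumn ta - sumn si))%N by rewrite /N; lia.
rewrite exprD !rmorphM; ring.
Qed.

Lemma gd_cat d X Y : gd d (X ++ Y) = \sum_(k < d.+1) gd k X * gd (d - k) Y.
Proof.
elim: X d => [|x X IH] d.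
  rewrite big_ord_recl big1 ?addr0 => [|i _]; last by rewrite /= mul0r.
  by rewrite /= mul1r subn0.
rewrite [LHS]/=; under eq_bigr => k _ do rewrite IH big_distrr /=.
under [RHS]eq_bigr => k _ do rewrite /= big_distrl /=.
rewrite (big_antidiag d (fun k j => f (qpoch k)^-1 * x ^+ k * (gd j X * gd (d - k - j) Y))).
apply: eq_bigr => i _; apply: eq_bigr => k _; have ki := ltn_ord k.
by rewrite mulrA -subnDA subnKC.
Qed.

Lemma gd_scale d X y : gd d [seq x * y | x <- X] = y ^+ d * gd d X.
Proof.
elim: X d => [|x X IH] d /=; first by case: d => [|d]; rewrite ?mulr0 // mulr1.
rewrite big_distrr; apply: eq_bigr => k _ /=; have kd := ltn_ord k.
have -> : y ^+ d = y ^+ k * y ^+ (d - k) by rewrite -exprD subnKC.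
by rewrite IH exprMn; ring.
Qed.

(** Branching off [y] leaves a strip of some size [k] between [ka] and [mu]; the sum over [mu] is
    then a Pieri sum and yields [gd k X], the contribution of the products of [y] with [X]. The
    factor [Bq mu] turns one of the two [Fh] into F_mu. *)
Lemma Cauchy D d X Y : (d <= D)%N ->
  \sum_(mu <- vecs D D.+1 | sumn mu == d) f (Bq mu) * Fh D mu X * Fh D mu Y
  = gd d [seq x * y | y <- Y, x <- X].
Proof.
elim: Y d => [|y Y IH] d dD.
  rewrite [RHS]/=; case: eqP => [->|d0].
    by rewrite big_vecs_sumn0 !Fh_nseq0 Bq_nseq0 rmorph1 !mulr1.
  by rewrite big1 // => mu /eqP /= ->; move/eqP/negbTE: d0 => ->; rewrite mulr0.
rewrite allpairs_cons gd_cat.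
transitivity (\sum_(k < d.+1) \sum_(ka <- vecs D D.+1 | sumn ka == (d - k)%N)
    (f (Bq ka) * y ^+ k * Fh D ka Y) *
     \sum_(mu <- vecs D D.+1 | sumn mu == d) f (Bq mu * Om mu ka) * Fh D mu X); last first.
  apply: eq_bigr => k _; have kd := ltn_ord k.
  rewrite gd_scale -(IH (d - k)%N); last by lia.
  rewrite big_distrr /= big_seq_cond [RHS]big_seq_cond.
  apply: eq_bigr => ka /andP[kv /eqP kE].
  have := @Pieri D ka k X kv; have -> : (sumn ka + k = d)%N by lia.
  by move=> -> //; ring.
rewrite (exchange_big_dep xpredT) //=.
transitivity (\sum_(ka <- vecs D D.+1) (f (Bq ka) * y ^+ (d - sumn ka) * Fh D ka Y) *
     \sum_(mu <- vecs D D.+1 | sumn mu == d) f (Bq mu * Om mu ka) * Fh D mu X).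
  under [RHS]eq_bigr => ka _ do rewrite big_distrr /=.
  rewrite [RHS](exchange_big_dep (fun mu => sumn mu == d)) //= big_seq_cond [RHS]big_seq_cond.
  apply: eq_bigr => mu /andP[/size_vecs -> /eqP ->].
  rewrite big_distrr /=; apply: eq_big => [ka|ka _]; first by rewrite eqxx.
  by rewrite !rmorphM; ring.
rewrite big_seq [RHS]big_seq; apply: eq_bigr => ka kv.
case: (leqP (sumn ka) d) => kd; last first.
  rewrite [RHS]big1; last by move=> k; have := ltn_ord k; lia.
  rewrite big_seq_cond big1 ?mulr0 // => mu /andP[/size_vecs sm /eqP md].
  have [->|om] := eqVneq (Om mu ka) 0; first by rewrite mulr0 rmorph0 mul0r.
  by have := Om_neq0_sumn (etrans sm (esym (size_vecs kv))) om; lia.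
have kk : (d - sumn ka < d.+1)%N by lia.
rewrite [RHS](big_pred1 (Ordinal kk)) //=.
move=> k /=; have := ltn_ord k => hk; apply/eqP/eqP => [h|-> /=]; last by lia.
by apply/val_inj => /=; lia.
Qed.

End Branching.

(** * Expansion of the kernel in power sums *)

Lemma big_triangle (V : nmodType) d (F : nat -> nat -> V) :
  \sum_(k < d.+1) \sum_(r < k) F k r =
  \sum_(r < d) \sum_(k < (d - r.+1).+1) F (r.+1 + k)%N r.
Proof.
elim: d => [|d IH]; first by rewrite big_ord1 !big_ord0.
rewrite big_ord_recr [RHS]big_ord_recr /= IH subnn big_ord1 addn0 big_ord_recr /= addrA.
congr (_ + _); rewrite -big_split; apply: eq_bigr => r _ /=; have rd := ltn_ord r.
by rewrite subSn // [RHS]big_ord_recr /=; congr (_ + F _ _); lia.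
Qed.

Lemma big_triangle_sub (V : nmodType) d (F : nat -> nat -> V) :
  \sum_(k < d.+1) \sum_(r < d - k) F k r =
  \sum_(r < d) \sum_(k < (d - r.+1).+1) F k r.
Proof.
rewrite (reindex_inj rev_ord_inj) /=.
under eq_bigr => k _ do rewrite subSS (subKn (leq_ord k)).
rewrite (big_triangle d (fun k r => F (d - k)%N r)); apply: eq_bigr => r _.
rewrite (reindex_inj rev_ord_inj) /=; apply: eq_bigr => k _.
by congr (F _ _); have := ltn_ord k; have := ltn_ord r; lia.
Qed.

Lemma geq_trans : transitive geq.
Proof. by move=> y x w xy yw; apply: leq_trans yw xy. Qed.

Lemma geq_anti : antisymmetric geq.
Proof. by move=> x y; rewrite andbC => /anti_leq. Qed.

Lemma geq_total : total geq.
Proof. by move=> x y; apply: leq_total. Qed.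

Lemma zpartE N la : all (fun r => r < N)%N la ->
  zpart la = ((\prod_(r <- la) r) * \prod_(i < N) (count_mem (i : nat) la)`!)%N.
Proof.
move=> laN; rewrite /zpart; congr (_ * _)%N.
rewrite -(big_mkord xpredT (fun i => (count_mem i la)`!)).
rewrite [RHS](bigID (fun i => i \in la)) /= [X in _ = (_ * X)%N]big1 ?muln1; last first.
  by move=> i /count_memPn ->.
rewrite -[RHS]big_filter; apply: perm_big; apply: uniq_perm.
- exact: undup_uniq.
- exact/filter_uniq/iota_uniq.
move=> i; rewrite mem_undup mem_filter mem_index_iota /=.
by case: (boolP (i \in la)) => //= /(allP laN).
Qed.

Lemma perm_zpart la mu : perm_eq la mu -> zpart la = zpart mu.
Proof.
move=> pe; have pc i : count_mem i la = count_mem i mu by exact/permP.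
have laN : all (fun r => r < (sumn la).+1)%N la.
  by apply/allP => r /perm_to_rem/perm_sumn /= ->; rewrite ltnS leq_addr.
have muN : all (fun r => r < (sumn la).+1)%N mu by rewrite -(perm_all _ pe).
rewrite (zpartE laN) (zpartE muN) (perm_big _ pe).
by congr (_ * _)%N; apply: eq_bigr => i _; rewrite pc.
Qed.

Lemma zpart_cons r la : zpart (r :: la) = (r * (count_mem r la).+1 * zpart la)%N.
Proof.
set N := (r + sumn la).+1.
have laN : all (fun i => i < N)%N la.
  by apply/allP => i /perm_to_rem/perm_sumn /= h; rewrite /N h; lia.
have rN : (r < N)%N by rewrite /N; lia.
rewrite (@zpartE N (r :: la)) /= ?rN // (zpartE laN) big_cons.
rewrite [X in (_ * X)%N = _](bigD1 (Ordinal rN)) //=.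
rewrite [in RHS](bigD1 (Ordinal rN)) //= eqxx add1n factS.
rewrite (eq_bigr (fun i : 'I_N => (count_mem (i : nat) la)`!)); first by rewrite -!mulnA; congr (_ * _)%N; rewrite mulnCA.
by move=> i; rewrite -val_eqE /= eq_sym => /negbTE ->.
Qed.

Lemma zpart_gt0 la : (0%N \notin la) -> (0 < zpart la)%N.
Proof.
elim: la => [|r la IH]; first by rewrite /zpart !big_nil.
rewrite inE negb_or zpart_cons eq_sym -lt0n => /andP[r0 /IH].
by rewrite !muln_gt0 r0.
Qed.

(** Removing one part [r] is a bijection from the partitions of [d] containing [r] onto those of
    [d - r]; sorting puts the part back. *)
Lemma big_parts_mem (V : nmodType) d r (G : seq nat -> V) : (0 < r <= d)%N ->
  \sum_(rho <- parts d | r \in rho) G rho =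
  \sum_(si <- parts (d - r)) G (sort geq (r :: si)).
Proof.
move=> /andP[r0 rd]; rewrite -big_filter -(big_map (fun si => sort geq (r :: si)) xpredT).
apply: perm_big; apply: uniq_perm.
- exact/filter_uniq/uniq_parts.
- rewrite map_inj_in_uniq ?uniq_parts // => s s'.
  rewrite !mem_parts => /andP[/andP[srt _] _] /andP[/andP[srt' _] _] ess.
  apply: (sorted_eq geq_trans geq_anti) => //.
  by rewrite -(perm_cons r) -(perm_sort geq) ess perm_sort.
move=> rho; rewrite mem_filter mem_parts; apply/idP/mapP => [|[si]].
  move=> /and3P[rr /andP[srt n0] /eqP sr].
  have pr := perm_to_rem rr; exists (rem r rho); last first.
    apply: (sorted_eq geq_trans geq_anti) => //; first exact/sort_sorted/geq_total.
    by rewrite (perm_trans pr) // perm_sym perm_sort.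
  rewrite mem_parts; move/perm_sumn: (pr) => /=; rewrite sr => ->.
  rewrite addKn eqxx andbT /is_part (subseq_sorted geq_trans (rem_subseq _ _)) //=.
  by apply: contra n0; apply: mem_rem.
rewrite mem_parts => /andP[/andP[srt n0] /eqP ss] ->.
rewrite mem_sort mem_head /= /is_part sort_sorted ?mem_sort; last exact: geq_total.
rewrite inE negb_or n0 (perm_sumn (_ : perm_eq _ (r :: si))) ?perm_sort //= ss.
by apply/andP; split; [lia | apply/eqP; lia].
Qed.

Lemma sumn_count N la : all (fun r => r < N)%N la ->
  sumn la = (\sum_(r < N) r * count_mem (r : nat) la)%N.
Proof.
elim: la => [|r la IH] /=; first by rewrite big1 // => i _; rewrite muln0.
move=> /andP[rN laN]; rewrite IH //.
rewrite (eq_bigr (fun i : 'I_N => i * (r == i) + i * count_mem (i : nat) la))%N.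
  rewrite big_split /=; congr (_ + _)%N; rewrite (bigD1 (Ordinal rN)) //= eqxx muln1 big1 ?addn0 //.
  by move=> i; rewrite -val_eqE /= eq_sym => /negbTE ->; rewrite muln0.
by move=> i _; rewrite mulnDr.
Qed.

Section Newton.

Variables (K : fieldType) (z : K).
Hypothesis z_neq1 : forall n, 1 - z ^+ n.+1 != 0.
Hypothesis K_char0 : forall n, n.+1%:R != 0 :> K.
Variables (S : comNzRingType) (f : {rmorphism K -> S}).
Local Notation qpoch := (qpoch z).
Local Notation gd := (gd z f).

(* Logarithmic derivative of 1 / (x; q)_oo. *)
Lemma qpoch_newton k : k%:R / qpoch k =
  \sum_(r < k) (1 - z ^+ r.+1)^-1 / qpoch (k - r.+1).
Proof.
have tele n : \sum_(r < n.+1) z ^+ r / qpoch r = (qpoch n)^-1.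
  elim: n => [|n IH]; first by rewrite big_ord1 expr0 mul1r.
  rewrite big_ord_recr /= IH qpochS; have := z_neq1 n; have := qpoch_neq0 z_neq1 n.
  by move=> h1 h2; field; rewrite ?h1 ?h2.
elim: k => [|k IH]; first by rewrite big_ord0 mul0r.
apply: (mulfI (z_neq1 k)).
transitivity (k%:R / qpoch k + (qpoch k)^-1).
  rewrite qpochS -natr1; have := z_neq1 k; have := qpoch_neq0 z_neq1 k.
  by move=> h1 h2; field; rewrite ?h1 ?h2.
rewrite IH -{1}tele [in LHS]addrC (reindex_inj rev_ord_inj) /=.
rewrite big_distrr /=.
(* Termwise, [z^(k-r) + (1 - z^(k-r)) / (1 - z^(r+1))] equals [(1 - z^(k+1)) / (1 - z^(r+1))]. *)
transitivity (\sum_(r < k.+1) (z ^+ (k - r) / qpoch (k - r)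
     + (1 - z ^+ (k - r)) / (1 - z ^+ r.+1) / qpoch (k - r))).
  rewrite big_split /=; congr (_ + _).
  rewrite [RHS]big_ord_recr /= subnn expr0 subrr !mul0r addr0.
  apply: eq_bigr => r _; have rk := ltn_ord r.
  rewrite -[in RHS](subnSK rk) qpochS; have := z_neq1 (k - r.+1).
  have := z_neq1 r; have := qpoch_neq0 z_neq1 (k - r.+1).
  by move=> h1 h2 h3; field; rewrite ?h1 ?h2 ?h3.
apply: eq_bigr => r _; have rk := ltn_ord r.
have -> : (k.+1 - r.+1 = k - r)%N by lia.
have -> : z ^+ k.+1 = z ^+ (k - r) * z ^+ r.+1 by rewrite -exprD; congr (_ ^+ _); lia.
have := z_neq1 r; have := qpoch_neq0 z_neq1 (k - r) => h1 h2.
by field; rewrite ?h1 ?h2.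
Qed.

Definition power_sum (X : seq S) r := \sum_(x <- X) x ^+ r.

(** The logarithmic derivative turns the product over the variables into a sum. Leibniz' rule is the
    splitting of [d] into [k] and [d - k]: the new variable is treated by [qpoch_newton], the others
    by induction. *)
Lemma gd_newton d X : d%:R * gd d X =
  \sum_(r < d) f (1 - z ^+ r.+1)^-1 * power_sum X r.+1 * gd (d - r.+1) X.
Proof.
elim: X d => [|x X IH] d.
  rewrite /=; case: d => [|d]; first by rewrite mul0r big_ord0.
  by rewrite mulr0 big1 // => r _; rewrite /power_sum big_nil mulr0 mul0r.
transitivity (\sum_(k < d.+1)
   (\sum_(r < k) f (1 - z ^+ r.+1)^-1 * f (qpoch (k - r.+1))^-1 * x ^+ k * gd (d - k) X
   + \sum_(r < d - k) f (1 - z ^+ r.+1)^-1 * f (qpoch k)^-1 * x ^+ k *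
       power_sum X r.+1 * gd (d - k - r.+1) X)).
  rewrite [LHS]/= big_distrr /=; apply: eq_bigr => k _; have kd := ltn_ord k.
  have -> : d%:R = k%:R + (d - k)%:R :> S by rewrite -natrD subnKC.
  rewrite mulrDl; congr (_ + _).
    rewrite !mulrA; do 2 rewrite -mulr_suml; congr (_ * _ * _).
    rewrite -(rmorph_nat f) -rmorphM qpoch_newton rmorph_sum.
    by apply: eq_bigr => r _; rewrite rmorphM.
  rewrite mulrCA IH big_distrr /=; apply: eq_bigr => r _; ring.
rewrite big_split /= (big_triangle d (fun k r => f (1 - z ^+ r.+1)^-1 *
  f (qpoch (k - r.+1))^-1 * x ^+ k * gd (d - k) X)).
rewrite (big_triangle_sub d (fun k r => f (1 - z ^+ r.+1)^-1 * f (qpoch k)^-1 *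
  x ^+ k * power_sum X r.+1 * gd (d - k - r.+1) X)) -big_split /=.
apply: eq_bigr => r _; have rd := ltn_ord r.
rewrite /power_sum big_cons big_distrr -big_split /=; apply: eq_bigr => k _.
have -> : (r.+1 + k - r.+1 = k)%N by lia.
have -> : (d - (r.+1 + k) = d - r.+1 - k)%N by lia.
have -> : (d - k - r.+1 = d - r.+1 - k)%N by lia.
by rewrite exprD; ring.
Qed.

(** The inverse of z_rho(q), that is, of z_rho(q,t) at t = 0. *)
Definition zq_coef (rho : seq nat) : K :=
  ((zpart rho)%:R * \prod_(r <- rho) (1 - z ^+ r))^-1.

Lemma zq_coef_neq0 rho : (0%N \notin rho) -> zq_coef rho != 0.
Proof.
move=> r0; rewrite /zq_coef invr_eq0 mulf_neq0 //.
  by have := zpart_gt0 r0; case: (zpart rho).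
rewrite prodf_seq_neq0; apply/allP => -[|r] rr //=.
by rewrite rr in r0.
Qed.

(** The size [d] is the sum of r m_r(rho), with m_r the multiplicity of [r], and r m_r(rho) / z_rho
    is 1 / z of [rho] with one part [r] removed. *)
Lemma zq_newton (y : nat -> S) d :
  d%:R * (\sum_(rho <- parts d) f (zq_coef rho) * \prod_(r <- rho) y r) =
  \sum_(r < d) f (1 - z ^+ r.+1)^-1 * y r.+1 *
     \sum_(rho <- parts (d - r.+1)) f (zq_coef rho) * \prod_(r <- rho) y r.
Proof.
transitivity (\sum_(r < d) \sum_(rho <- parts d | r.+1 \in rho)
    f ((r.+1 * count_mem r.+1 rho)%:R * zq_coef rho) * \prod_(r <- rho) y r).
  rewrite (exchange_big_dep xpredT) //= big_distrr /= big_seq [RHS]big_seq.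
  apply: eq_bigr => rho; rewrite mem_parts => /andP[/andP[_ n0] /eqP sr].
  rewrite -big_distrl /= mulrA; congr (_ * _).
  rewrite -(rmorph_nat f) -rmorphM -rmorph_sum; congr (f _).
  rewrite -mulr_suml; congr (_ * _); rewrite -natr_sum; congr _%:R.
  rewrite -sr big_mkcond /=.
  transitivity (\sum_(r < (sumn rho).+1) (r * count_mem (r : nat) rho))%N.
    by apply: sumn_count; apply/allP => r /perm_to_rem/perm_sumn /= ->; rewrite ltnS leq_addr.
  rewrite big_ord_recl mul0n add0n; apply: eq_bigr => i _ /=.
  by case: ifP => // /negbT/count_memPn ->; rewrite muln0.
apply: eq_bigr => r _; have rd := ltn_ord r.
rewrite big_parts_mem // big_distrr /= big_seq [RHS]big_seq.
apply: eq_bigr => si; rewrite mem_parts => /andP[/andP[_ n0] _].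
have ps : perm_eq (sort geq (r.+1 :: si)) (r.+1 :: si) by rewrite perm_sort.
rewrite (perm_big _ ps) big_cons /= !mulrA; congr (_ * _).
rewrite mulrAC -rmorphM; congr (f _ * _).
rewrite /zq_coef (perm_zpart ps) zpart_cons (perm_big _ ps) big_cons.
have /permP -> := ps; rewrite /= eqxx add1n (natrM _ _ (zpart si)) !(natrM _ r.+1 _).
have c0 := K_char0 (count_mem r.+1 si); have c1 := K_char0 r.
have z0 := zq_coef_neq0 n0; rewrite /zq_coef invr_eq0 mulf_eq0 negb_or in z0.
move/andP: z0 => [z0 p0]; have := z_neq1 r => r0.
move: (_.+1%:R) c0 (_.+1%:R) c1 ((zpart si)%:R) z0 (\prod_(_ <- _) _) p0 (1 - _) r0.
by move=> c c0 e e0 v v0 p p0 w w0; field; rewrite c0 e0 v0 p0 w0.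
Qed.

(** Both sides are 1 in degree 0 and satisfy the same Newton recursion, which determines them since
    [d] is invertible in [K]. *)
Lemma gd_power_sums d X :
  gd d X = \sum_(rho <- parts d) f (zq_coef rho) * \prod_(r <- rho) power_sum X r.
Proof.
elim/ltn_ind: d => -[|d] IH.
  rewrite big_seq1 big_nil mulr1 /zq_coef /zpart !big_nil mulr1 invr1 rmorph1.
  elim: X {IH} => //= x X h.
  by rewrite big_ord1 subn0 h qpoch0 invr1 rmorph1 expr0 !mulr1.
have finj : injective ( *%R (d.+1%:R : S)).
  move=> u v uv; have : f (d.+1%:R^-1) * d.+1%:R = 1.
    by rewrite -(rmorph_nat f) -rmorphM mulVf // rmorph1.
  by move=> h; rewrite -[u]mul1r -[v]mul1r -h -!mulrA uv.
apply: finj; rewrite gd_newton zq_newton; apply: eq_bigr => r _.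
by rewrite IH // ltnS subSS leq_subr.
Qed.

End Newton.

(** * Coefficients of the q-Whittaker polynomials *)

Definition pad (L : nat) (la : seq nat) : seq nat := la ++ nseq (L - size la) 0%N.

Lemma size_pad L la : (size la <= L)%N -> size (pad L la) = L.
Proof. by move=> h; rewrite size_cat size_nseq subnKC. Qed.

Lemma nth_pad L la i : nth 0%N (pad L la) i = nth 0%N la i.
Proof.
rewrite nth_cat; case: ltnP => // h.
by rewrite nth_nseq if_same nth_default.
Qed.

Lemma sumn_pad L la : sumn (pad L la) = sumn la.
Proof. by rewrite sumn_cat sumn_nseq0 addn0. Qed.

Lemma sumn_take_nseq0 a b : sumn (take a (nseq b 0%N)) = 0%N.
Proof. by elim: b a => [|b IH] [|a] //=; apply: IH. Qed.

Lemma sumn_take_pad L la k : sumn (take k (pad L la)) = sumn (take k la).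
Proof.
rewrite take_cat; case: ltnP => // h; rewrite sumn_cat (take_oversize h).
by rewrite sumn_take_nseq0 addn0.
Qed.

Lemma leq_sumn_mem i v : i \in v -> (i <= sumn v)%N.
Proof. by move=> /perm_to_rem/perm_sumn /= ->; apply: leq_addr. Qed.

Lemma size_part la : is_part la -> (size la <= sumn la)%N.
Proof.
move=> /andP[_]; elim: la => //= a la IH; rewrite inE negb_or => /andP[a0 /IH].
by lia.
Qed.

Lemma filter_pad L la : 0%N \notin la -> [seq r <- pad L la | (0 < r)%N] = la.
Proof.
move=> n0; rewrite filter_cat.
have -> : [seq r <- la | (0 < r)%N] = la.
  by apply/all_filterP/allP => -[|r] // rr; rewrite rr in n0.
by elim: (L - size la)%N => [|k IH] /=; rewrite ?cats0.
Qed.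

Lemma pad_filter v : sorted geq v -> pad (size v) [seq r <- v | (0 < r)%N] = v.
Proof.
elim: v => [|[|a] v IH] //= srt.
  have -> : v = nseq (size v) 0%N.
    apply/all_pred1P; have := order_path_min geq_trans srt.
    by apply: sub_all => x /=; rewrite leqn0.
  set w := [seq _ <- _ | _]; have -> : w = [::].
    by apply/eqP; rewrite -size_eq0 size_filter; elim: (size v).
  by rewrite /pad /= size_nseq.
by rewrite /pad /= subSS; congr (_ :: _); apply/IH/(path_sorted srt).
Qed.

Lemma sorted_pad L la : sorted geq la -> sorted geq (pad L la).
Proof.
move=> srt; apply/(sortedP 0%N) => i _; rewrite !nth_pad /=.
case: (ltnP i.+1 (size la)) => h; last by rewrite (nth_default _ h).
exact: (sortedP 0%N srt).
Qed.

Lemma pad_vecs d la : la \in parts d -> pad d.+1 la \in vecs d d.+1.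
Proof.
rewrite mem_parts => /andP[pla /eqP sla]; rewrite mem_vecs size_pad ?eqxx /=.
  by apply/allP => i /leq_sumn_mem; rewrite sumn_pad sla.
by rewrite -sla leqW // size_part.
Qed.

Lemma big_vecs_parts (V : nmodType) d (F : seq nat -> V) :
  (forall v, ~~ sorted geq v -> F v = 0) ->
  \sum_(v <- vecs d d.+1 | sumn v == d) F v =
  \sum_(la <- parts d) F (pad d.+1 la).
Proof.
move=> F0; rewrite (bigID (sorted geq)) /= [X in _ + X]big1 ?addr0; last first.
  by move=> v /andP[_ /F0].
rewrite -big_filter -(big_map (pad d.+1) xpredT); apply: perm_big; apply: uniq_perm.
- exact/filter_uniq/uniq_vecs.
- rewrite map_inj_in_uniq ?uniq_parts // => s t; rewrite !mem_parts.
  move=> /andP[/andP[_ s0] _] /andP[/andP[_ t0] _] st.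
  by rewrite -(filter_pad d.+1 s0) st filter_pad.
move=> v; rewrite mem_filter; apply/idP/mapP => [|[la pla ->]].
  move=> /andP[/andP[/eqP sv srt] vv]; exists [seq r <- v | (0 < r)%N].
    rewrite mem_parts /is_part sorted_filter ?mem_filter //=; last exact: geq_trans.
    by rewrite -(sumn_pad (size v)) pad_filter // sv.
  by rewrite -{1}(pad_filter srt) (size_vecs vv).
rewrite pad_vecs // sumn_pad; move: pla; rewrite mem_parts => /andP[/andP[srt _] ->].
by rewrite sorted_pad.
Qed.

Lemma sum_neq0 (V : nmodType) (I : eqType) (r : seq I) (P : pred I) (F : I -> V) :
  \sum_(i <- r | P i) F i != 0 -> exists2 i, i \in r & P i && (F i != 0).
Proof.
move=> nz; apply/hasP; apply: contraNT nz => /hasPn h.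
rewrite big_seq_cond big1 // => i /andP[/h]; rewrite negb_and negbK => + Pi.
by rewrite Pi => /eqP.
Qed.

Lemma leq_sumn_take k u v : (forall i, nth 0 u i <= nth 0 v i)%N ->
  (sumn (take k u) <= sumn (take k v))%N.
Proof.
elim: k u v => [|k IH] u v; first by rewrite !take0.
case: u => [|a u] //=; case: v => [|b v] /= h.
  have := h 0%N; rewrite /= leqn0 => /eqP ->.
  by apply: (IH u [::]) => i; rewrite nth_nil; exact: (h i.+1).
by apply: leq_add; [exact: (h 0%N) | apply: IH => i; exact: (h i.+1)].
Qed.

Lemma leq_sumn_nth u v : (forall i, nth 0 u i <= nth 0 v i)%N -> (sumn u <= sumn v)%N.
Proof.
move=> h; have := leq_sumn_take (size u + size v) h.
by rewrite !take_oversize ?leq_addl ?leq_addr.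
Qed.

Lemma eq_sumn_take u v : size u = size v ->
  (forall k, sumn (take k u) = sumn (take k v)) -> u = v.
Proof.
elim: u v => [|a u IH] [|b v] //= [sz] h.
have /= := h 1%N; rewrite !take0 /= !addn0 => ab; subst b.
by congr (_ :: _); apply: IH => // k; have /= /addnI := h k.+1.
Qed.

Section Coefficients.

Variables (K : fieldType) (z : K).
Hypothesis z_neq1 : forall n, 1 - z ^+ n.+1 != 0.
Local Notation qpoch := (qpoch z).
Local Notation ih := (ih z).
Local Notation Om := (Om z).
Local Notation Bq := (Bq z).

(* The entries of w are the sizes of the successive strips, outermost first. *)
Fixpoint Ah (D : nat) (mu w : seq nat) : K :=
  if w is r :: w' then
    \sum_(ka <- vecs D (size mu) | (sumn ka + r == sumn mu)%N)
       Om mu ka * Bq ka * Ah D ka w'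
  else (sumn mu == 0%N)%:R.

Fixpoint mon (S : comNzRingType) (X : seq S) (w : seq nat) : S :=
  match X, w with
  | x :: X', r :: w' => x ^+ r * mon X' w'
  | _, _ => 1
  end.

Lemma Fh_expand (S : comNzRingType) (f : {rmorphism K -> S}) D mu X :
  (sumn mu <= D)%N ->
  Fh z f D mu X = \sum_(w <- vecs D (size X)) f (Ah D mu w) * mon X w.
Proof.
elim: X mu => [|x X IH] mu mD; first by rewrite big_seq1 /= rmorph_nat mulr1.
rewrite big_vecsS /= exchange_big /=.
under [RHS]eq_bigr => w _ do under eq_bigr => r _ do rewrite rmorph_sum big_distrl /=.
under [RHS]eq_bigr => w _ do rewrite (exchange_big_dep xpredT) //=.
rewrite [RHS]exchange_big /= big_seq [RHS]big_seq; apply: eq_bigr => ka kv.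
have [->|om] := eqVneq (Om mu ka) 0.
  rewrite mul0r rmorph0 !mul0r big1 // => w _.
  by rewrite big1 // => r _; rewrite !mul0r rmorph0 mul0r.
have km := Om_neq0_sumn z_neq1 (esym (size_vecs kv)) om.
rewrite IH ?(leq_trans km) // big_distrr /=; apply: eq_bigr => w _.
have kk : (sumn mu - sumn ka < D.+1)%N by lia.
rewrite (big_pred1 (Ordinal kk)) /=; first by rewrite !rmorphM; ring.
move=> r /=; apply/eqP/eqP => [h|-> /=]; last by lia.
by apply/val_inj => /=; lia.
Qed.

Lemma Fh_morph (S S' : comNzRingType) (f : {rmorphism K -> S})
    (f' : {rmorphism K -> S'}) (g : {rmorphism S -> S'}) D mu X :
  (forall c, g (f c) = f' c) ->
  g (Fh z f D mu X) = Fh z f' D mu [seq g x | x <- X].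
Proof.
move=> gf; elim: X mu => [|x X IH] mu /=; first by rewrite rmorph_nat.
rewrite rmorph_sum; apply: eq_bigr => ka _.
by rewrite !(rmorphM g) rmorphXn /= gf IH.
Qed.

Lemma Ah_nsorted D mu w : ~~ sorted geq mu -> Ah D mu w = 0.
Proof.
case: w => [|r w] ns /=.
  case: eqP => // /sumn_eq0 mu0; case/negP: ns; rewrite mu0.
  by apply/(sortedP 0%N) => i _; rewrite !nth_nseq !if_same.
rewrite big_seq_cond big1 // => ka /andP[/size_vecs sk _].
have [->|om] := eqVneq (Om mu ka) 0; first by rewrite !mul0r.
by case/negP: ns; have [] := Om_neq0_sorted z_neq1 (esym sk) om.
Qed.

Lemma Om_diag la : sorted geq la -> Om la la * Bq la = 1.
Proof.
elim: la => [|a la IH] srt /=; first by rewrite mulr1.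
have le : (head 0%N la <= a)%N by case: la srt {IH} => //= b la /andP[].
have -> : forall u v w x y : K, u * v * w * (x * y) = u * (v * x) * (w * y) by move=> *; ring.
by rewrite IH ?(path_sorted srt) // ihnn ih_le // mulVf ?qpoch_neq0 // !mulr1.
Qed.

Lemma Om_neq0_eq la ka : size la = size ka -> sumn la = sumn ka ->
  Om la ka != 0 -> la = ka.
Proof.
elim: la ka => [|a la IH] [|b ka] //= [sz] sE.
rewrite !mulf_eq0 !negb_or !ih_neq0 // => /andP[/andP[ba _] om].
have := Om_neq0_sumn z_neq1 sz om => le.
have [-> sE'] : a = b /\ sumn la = sumn ka by lia.
by rewrite (IH _ sz sE').
Qed.

(** An empty strip leaves the shape unchanged and has weight [Om mu mu * Bq mu = 1]. Used to drop
    the zeros of a padded content. *)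
Lemma Ah_cons0 D mu w : mu \in vecs D (size mu) -> Ah D mu (0%N :: w) = Ah D mu w.
Proof.
move=> mv; have [srt|ns] := boolP (sorted geq mu); last by rewrite !Ah_nsorted.
rewrite /= big_mkcond (bigD1_seq _ mv (uniq_vecs _ _)) /= addn0 eqxx Om_diag // mul1r.
rewrite big_seq_cond big1 ?addr0 // => ka /andP[/size_vecs sk nk].
rewrite addn0; case: eqP => // sE.
have [->|om] := eqVneq (Om mu ka) 0; first by rewrite !mul0r.
by case/eqP: nk; rewrite (Om_neq0_eq (esym sk) (esym sE) om).
Qed.

Lemma Bq_neq0 mu : Bq mu != 0.
Proof. by elim: mu => [|a mu IH] /=; rewrite ?oner_eq0 // mulf_neq0 ?qpoch_neq0. Qed.

Lemma Ah_nseq0 D mu w k : mu \in vecs D (size mu) ->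
  Ah D mu (nseq k 0%N ++ w) = Ah D mu w.
Proof. by move=> mv; elim: k => // k IH; rewrite -[RHS]IH; apply: Ah_cons0. Qed.

(** The innermost [k] strips fill a shape with at most [k] rows inside [mu], so they have at most as
    many cells as its first [k] rows. The bound on the number of rows is part of the induction. *)
Lemma Ah_neq0 D mu w : mu \in vecs D (size mu) -> Ah D mu w != 0 ->
  [/\ sumn w = sumn mu,
      forall k, (sumn (take k (rev w)) <= sumn (take k mu))%N
    & sumn (drop (size w) mu) = 0%N].
Proof.
elim: w mu => [|r w IH] mu mv.
  rewrite /=; have [m0 _|] := eqVneq (sumn mu) 0%N; last by rewrite eqxx.
  by rewrite drop0; split.
move=> /= nz.
have [ka kv /andP[/eqP sE]] := sum_neq0 nz.
rewrite !mulf_eq0 !negb_or => /andP[/andP[om _] Ak].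
have sk := size_vecs kv; have om_nth := Om_neq0_nth z_neq1 (esym sk) om.
have [sw tk dk] : [/\ sumn w = sumn ka,
      forall k, (sumn (take k (rev w)) <= sumn (take k ka))%N
    & sumn (drop (size w) ka) = 0%N] by apply: IH => //; rewrite sk.
have d0 : sumn (drop (size w).+1 mu) = 0%N.
  apply/eqP; rewrite -leqn0 -dk; apply: leq_sumn_nth => i; rewrite !nth_drop addSn.
  by case: (om_nth (size w + i)%N).
split=> //; first by lia.
move=> k; rewrite rev_cons -cats1; case: (leqP k (size w)) => kw.
  rewrite takel_cat ?size_rev //; apply: leq_trans (tk k) _.
  by apply: leq_sumn_take => i; case: (om_nth i).
apply: (@leq_trans (sumn mu)).
  rewrite -sE -sw addnC -[X in (_ <= X)%N](_ : sumn (rev w ++ [:: r]) = _)%N.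
    by rewrite -{2}(cat_take_drop k (rev w ++ [:: r])) sumn_cat leq_addr.
  by rewrite sumn_cat /= addn0 (perm_sumn (_ : perm_eq _ w)) ?perm_rev // addnC.
rewrite -{1}(cat_take_drop k mu) sumn_cat -(subnK kw) -drop_drop.
set v := drop _ mu in d0 *; suff -> : sumn (drop (k - (size w).+1) v) = 0%N by rewrite addn0.
by apply/eqP; rewrite -leqn0 -d0 -{2}(cat_take_drop (k - (size w).+1) v) sumn_cat leq_addl.
Qed.

(** A strip consisting of the whole bottom row has psi equal to 1. *)
Lemma Bq_Om_rcons u r k : sorted geq (rcons u r) ->
  Bq (u ++ r :: nseq k 0%N) * Om (u ++ r :: nseq k 0%N) (u ++ nseq k.+1 0%N) = 1.
Proof.
have h0 j : head 0%N (nseq j 0%N) = 0%N by case: j.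
elim: u => [|a u IH] srt.
  rewrite /= h0 subn0 Bq_nseq0 Om_nseq0 ihnn ih_le // subn0 !mulr1.
  by rewrite mulfV // qpoch_neq0.
set la := u ++ r :: nseq k 0%N in IH *; set ka := u ++ nseq k.+1 0%N in IH *.
have le : (head 0%N la <= a)%N.
  by rewrite /la; case: (u) srt => [|b v] /= /andP[].
rewrite /= -/la -/ka ihnn mul1r.
have -> : forall u v w x : K, u * v * (w * x) = (u * w) * (v * x) by move=> *; ring.
by rewrite IH ?(path_sorted srt) // ih_le // mulfV ?qpoch_neq0 // mulr1.
Qed.

(** Only the chain that removes the bottom row at every step contributes. *)
Lemma Ah_diag D u k : sorted geq u -> u ++ nseq k 0%N \in vecs D (size u + k) ->
  Bq (u ++ nseq k 0%N) * Ah D (u ++ nseq k 0%N) (rev u) = 1.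
Proof.
elim/last_ind: u k => [|u r IH] k srt; first by rewrite /= Bq_nseq0 sumn_nseq0 mulr1.
rewrite rev_rcons cat_rcons size_rcons => lv.
have srtu : sorted geq u by move: srt; rewrite -cats1 => /cat_sorted2[].
have kv : u ++ nseq k.+1 0%N \in vecs D (size u + k.+1).
  move: lv; rewrite !mem_vecs !size_cat /= !size_nseq eqxx addSnnS eqxx /=.
  by rewrite !all_cat /= => /and3P[-> _ ->].
have slv : size (u ++ r :: nseq k 0%N) = (size u + k.+1)%N by rewrite size_cat /= size_nseq.
rewrite [Ah _ _ _]/= slv big_mkcond (bigD1_seq _ kv (uniq_vecs _ _)) /= big_seq_cond big1.
  rewrite addr0 !sumn_cat /= sumn_nseq0 !addn0 eqxx.
  have := Bq_Om_rcons k srt; rewrite /= => e.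
  by rewrite !mulrA e mul1r; exact: (IH k.+1 srtu kv).
move=> ka /andP[kav nka]; case: eqP => // sE.
have sk := size_vecs kav.
have [->|om] := eqVneq (Om (u ++ r :: nseq k 0%N) ka) 0; first by rewrite !mul0r.
have [->|Ak] := eqVneq (Ah D ka (rev u)) 0; first by rewrite mulr0.
case/eqP: nka.
have om_nth := Om_neq0_nth z_neq1 (etrans slv (esym sk)) om.
have [sw tk _] : [/\ sumn (rev u) = sumn ka,
      forall k, (sumn (take k (rev (rev u))) <= sumn (take k ka))%N
    & sumn (drop (size (rev u)) ka) = 0%N] by apply: Ah_neq0 Ak; rewrite sk.
rewrite revK in tk; rewrite (perm_sumn (_ : perm_eq _ u)) ?perm_rev // in sw.
(* The partial sums of [ka] are bounded above by interlacing and below by [Ah_neq0]; the bounds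
   agree. *)
apply: eq_sumn_take => [|j]; first by rewrite sk size_cat /= size_nseq.
apply/eqP; rewrite eqn_leq; case: (leqP j (size u)) => ju.
  rewrite takel_cat // tk andbT.
  rewrite (leq_trans (leq_sumn_take j (fun i => proj1 (om_nth i)))) //.
  by rewrite takel_cat.
rewrite take_cat ltnNge (ltnW ju) sumn_cat (sumn_take_nseq0 _ k.+1) addn0 sw.
have -> /= : (sumn (take j ka) <= sumn ka)%N.
  by rewrite -{2}(cat_take_drop j ka) sumn_cat leq_addr.
rewrite -sw.
by have := tk j; rewrite take_oversize // ltnW.
Qed.

Section Monomials.

Variables (R : comNzRingType) (n : nat).

Definition mnm_of (s : seq 'I_n) (w : seq nat) : 'X_{1..n} :=
  [multinom nth 0%N w (index i s) | i < n].

Lemma mon_mpolyX s w : uniq s -> size w = size s ->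
  mon [seq 'X_i | i <- s] w = 'X_[mnm_of s w] :> {mpoly R[n]}.
Proof.
elim: s w => [|i s IH] [|r w] //=.
  by move=> _ _; rewrite -mpolyX0; congr 'X_[_]; apply/mnmP => j; rewrite !mnmE.
move=> /andP[ins us] [sz]; rewrite IH // mpolyXn -mpolyXD; congr 'X_[_].
apply/mnmP => j; rewrite mnmDE mulmnE mnm1E !mnmE /=.
have [ij|ij] := eqVneq i j; last by rewrite mul0n.
rewrite -ij mul1n nth_default ?addn0 //.
by rewrite (memNindex ins) sz.
Qed.

Lemma mnm_of_eq s w m : uniq s -> size w = size s -> (forall i, i \in s) ->
  (mnm_of s w == m) = (w == [seq m i | i <- s]).
Proof.
move=> us sz sA; apply/eqP/eqP => [<-|->].
  apply: (@eq_from_nth _ 0%N) => [|j js]; first by rewrite size_map.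
  rewrite sz in js; have i0 : 'I_n by case: s js {us sz sA}.
  by rewrite (nth_map i0) // mnmE index_uniq.
apply/mnmP => i; rewrite mnmE (nth_map i) ?nth_index //.
by rewrite index_mem.
Qed.

End Monomials.

Lemma mcoeff_Fh n (f : {rmorphism K -> {mpoly K[n]}}) D mu (s : seq 'I_n) (m : 'X_{1..n}) :
  (forall c, f c = c%:MP) -> (sumn mu <= D)%N -> uniq s -> (forall i, i \in s) ->
  (forall i, m i <= D)%N ->
  (Fh z f D mu [seq 'X_i | i <- s])@_m = Ah D mu [seq m i | i <- s].
Proof.
move=> fC mD us sA mi; rewrite Fh_expand // raddf_sum size_map big_seq.
rewrite (eq_bigr (fun w => Ah D mu w * (w == [seq m i | i <- s])%:R)); last first.
  move=> w /size_vecs sw; rewrite fC /= mcoeffCM.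
  by rewrite mon_mpolyX // mcoeffX mnm_of_eq.
have wv : [seq m i | i <- s] \in vecs D (size s).
  rewrite mem_vecs size_map eqxx /=; apply/allP => j /mapP[i _ ->].
  exact: mi.
rewrite -big_seq (bigD1_seq _ wv (uniq_vecs _ _)) /= eqxx mulr1 big1 ?addr0 //.
by move=> w /negbTE ->; rewrite mulr0.
Qed.

Hypothesis K_char0 : forall n, n.+1%:R != 0 :> K.

Definition mpart (n : nat) (la : seq nat) : 'X_{1..n} :=
  [multinom nth 0%N la i | i < n].

Lemma map_mpart n la : (size la <= n)%N ->
  [seq mpart n la i | i <- rev (enum 'I_n)] = rev (pad n la).
Proof.
move=> h; rewrite map_rev; congr rev; apply: (@eq_from_nth _ 0%N).
  by rewrite size_map size_enum_ord size_pad.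
move=> i; rewrite size_map size_enum_ord => hi.
rewrite (nth_map (Ordinal hi)) ?size_enum_ord // mnmE nth_enum_ord //.
by rewrite nth_pad.
Qed.

(* a_(mu nu) as the sum over chains of the products of psi. *)
Definition Acoef d mu nu : K :=
  Bq (pad d.+1 mu) * Ah d (pad d.+1 mu) (rev (pad d nu)).

(* Both sides are the coefficient of x^la y^nu in the Cauchy kernel. *)
Lemma gram d la nu : la \in parts d -> nu \in parts d ->
  \sum_(mu <- parts d) (Bq (pad d.+1 mu))^-1 * Acoef d mu la * Acoef d mu nu =
  \sum_(rho <- parts d) zq_coef z rho
    * (psymf K rho d)@_(mpart d la) * (psymf K rho d)@_(mpart d nu).
Proof.
move=> pl pn.
have ple mu : mu \in parts d -> (forall i, mpart d mu i <= d)%N /\ (size mu <= d)%N.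
  rewrite mem_parts => /andP[pmu /eqP <-]; split; last exact: size_part.
  move=> i; rewrite mnmE; case: (ltnP i (size mu)) => h.
    by apply: leq_sumn_mem; rewrite mem_nth.
  by rewrite nth_default.
have [[lad lasz] [nud nusz]] := (ple _ pl, ple _ pn).
(* Two alphabets: [{mpoly S1[d]}] is K[x][y], where [g1] places a polynomial in the inner variables
   and [g2] in the outer ones. *)
pose S1 : comNzRingType := {mpoly K[d]}.
pose f1 : {rmorphism K -> S1} := @mpolyC d K.
pose g1 : {rmorphism S1 -> {mpoly S1[d]}} := @mpolyC d S1.
pose g2 : {rmorphism S1 -> {mpoly S1[d]}} := map_mpoly (@mpolyC d K).
pose f2 : {rmorphism K -> {mpoly S1[d]}} := g1 \o f1.
(* The first variable of [Fh] records the outermost strip, whose size is the last part of the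
   content; hence the reversal. *)
set s := rev (enum 'I_d).
have us : uniq s by rewrite rev_uniq enum_uniq.
have sA i : i \in s by rewrite mem_rev mem_enum.
pose X1 : seq S1 := [seq 'X_i | i <- s].
pose G mu := Fh z f1 d mu X1.
pose p rho : S1 := psymf K rho d.
have g2C c : g2 (f1 c) = f2 c by rewrite /g2 /= map_mpolyC.
have main : \sum_(mu <- vecs d d.+1 | sumn mu == d) f2 (Bq mu) * g1 (G mu) * g2 (G mu) =
    \sum_(rho <- parts d) f2 (zq_coef z rho) * (g1 (p rho) * g2 (p rho)).
  transitivity (gd z f2 d [seq x * y | y <- map g2 X1, x <- map g1 X1]).
    rewrite -(@Cauchy _ _ z_neq1 _ f2 d) //; apply: eq_bigr => mu _.
    by rewrite (@Fh_morph _ _ f1 f2 g1) // (@Fh_morph _ _ f1 f2 g2).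
  rewrite gd_power_sums //; apply: eq_bigr => rho _; congr (_ * _).
  rewrite /p /psymf !rmorph_prod -big_split; apply: eq_bigr => r _ /=.
  have -> : \sum_(i < d) 'X_i ^+ r = \sum_(x <- X1) x ^+ r.
    rewrite /X1 /s big_map [RHS](perm_big (enum 'I_d)) ?perm_rev //=.
    by rewrite big_enum.
  rewrite /power_sum big_allpairs_dep !rmorph_sum big_map big_distrr /=.
  apply: eq_bigr => y _; rewrite big_distrl big_map /=; apply: eq_bigr => x _.
  by rewrite exprMn !rmorphXn.
have coefE (c : K) (u v : S1) :
    ((f2 c * g1 u * g2 v)@_(mpart d la))@_(mpart d nu) = c * v@_(mpart d la) * u@_(mpart d nu).
  rewrite /f2 /g1 /g2 /= -mulrA !mcoeffCM mcoeff_map_mpoly.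
  by rewrite [u * _]mulrC !mcoeffCM mulrA.
have GE mu nu' : sumn mu = d -> nu' \in parts d ->
    (G mu)@_(mpart d nu') = Ah d mu (rev (pad d nu')).
  move=> sm /ple[nd nsz].
  by rewrite /G /X1 mcoeff_Fh ?sm // map_mpart.
have := congr1 (fun u => (u@_(mpart d la))@_(mpart d nu)) main.
rewrite !raddf_sum /= => main'.
under [RHS]eq_bigr => rho _ do rewrite -coefE -mulrA.
pose F v := Bq v * Ah d v (rev (pad d la)) * Ah d v (rev (pad d nu)).
transitivity (\sum_(mu <- parts d) F (pad d.+1 mu)).
  apply: eq_bigr => mu _; rewrite /Acoef /F.
  by have := Bq_neq0 (pad d.+1 mu) => h; field.
rewrite -main' -big_vecs_parts; last first.
  by move=> v ns; rewrite /F Ah_nsorted ?mulr0 ?mul0r.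
by apply: eq_bigr => mu /eqP sm; rewrite coefE !GE.
Qed.

End Coefficients.

(** * Uniqueness of orthogonal unitriangular bases *)

Section Unitriangular.

Variables (F : fieldType) (N : nat) (stat : 'I_N -> nat).

Definition unitriangular (A : 'M[F]_N) : Prop :=
  forall i j, A i i = 1 /\ (A i j != 0 -> i != j -> (stat j < stat i)%N).

(** Choose [j] of largest statistic in the support of [y]: another [k] in the support with [A k j]
    nonzero would have a larger one. *)
Lemma unitriangular_top (A : 'M[F]_N) (y : 'rV_N) : unitriangular A -> y != 0 ->
  exists j, y 0 j != 0 /\ (y *m A) 0 j = y 0 j.
Proof.
move=> HA /rV0Pn[j0 yj0].
have [j yj jmax] := @arg_maxnP _ j0 (fun j => y 0 j != 0) stat yj0.
exists j; split=> //; rewrite mxE (bigD1 j) //= (proj1 (HA j j)) mulr1.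
rewrite big1 ?addr0 // => k kj.
have [->|yk] := eqVneq (y 0 k) 0; first by rewrite mul0r.
have [->|Akj] := eqVneq (A k j) 0; first by rewrite mulr0.
by have /= := jmax k yk; rewrite leqNgt (proj2 (HA k j)).
Qed.

Lemma unitriangular_unit A : unitriangular A -> A \in unitmx.
Proof.
move=> HA; rewrite -row_free_unit -kermx_eq0; apply/eqP/row_matrixP => i.
rewrite row0; apply/eqP/negPn/negP => /(unitriangular_top HA)[j [nz]].
by rewrite -row_mul mulmx_ker row0 mxE => h; rewrite -h eqxx in nz.
Qed.

(* Uniqueness of the Gram-Schmidt basis. *)
Lemma unitriangular_orthogonal (A C M : 'M[F]_N) :
  unitriangular A -> unitriangular C ->
  (forall i j, ((A *m M *m A^T) i j != 0) = (i == j)) ->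
  (forall i j, i != j -> (C *m M *m C^T) i j = 0) -> C = A.
Proof.
move=> HA HC orA orC; have uA := unitriangular_unit HA.
have formE (X Y : 'M[F]_N) i j : (X *m M *m Y^T) i j = (row i X *m M *m (row j Y)^T) 0 0.
  by rewrite tr_row -row_mul mxE [RHS]mxE; apply: eq_bigr => k _; rewrite !mxE.
suff rowE n i : (stat i < n)%N -> row i C = row i A.
  by apply/row_matrixP => i; apply: (rowE (stat i).+1).
elim: n i => // n IH i; rewrite ltnS => sin.
set v := row i C - row i A; suff : v = 0 by move/eqP; rewrite subr_eq0 => /eqP.
have v_lt j : v 0 j != 0 -> (stat j < stat i)%N.
  rewrite !mxE; have [->|ij] := eqVneq i j.
    by rewrite (proj1 (HA j j)) (proj1 (HC j j)) subrr eqxx.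
  have [-> |Aij _] := eqVneq (A i j) 0; last by apply: (proj2 (HA i j)).
  by rewrite subr0 => Cij; apply: (proj2 (HC i j)).
(* The coordinates of [v] in the rows of [A]. Orthogonality to the rows of smaller statistic, where
   [A] and [C] agree, kills the corresponding coordinates, whereas [unitriangular_top] would give a
   nonzero one there, since [v] is supported on smaller statistics. *)
pose y := v *m invmx A; have yA : y *m A = v by rewrite mulmxKV.
have y0 j : (stat j < stat i)%N -> y 0 j = 0.
  move=> sj; have ij : i != j by apply: contraTneq sj => ->; rewrite ltnn.
  have : (v *m M *m (row j A)^T) 0 0 = 0.
    have e1 : (row i C *m M *m (row j A)^T) 0 0 = 0.
      by rewrite -(IH j) ?(leq_trans sj) // -formE orC.
    have e2 : (row i A *m M *m (row j A)^T) 0 0 = 0.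
      by rewrite -formE; have := orA i j; rewrite (negbTE ij) => /negbFE/eqP.
    by rewrite !mulmxBl mxE e1 mxE e2 subrr.
  have -> : v *m M *m (row j A)^T = y *m col j (A *m M *m A^T).
    by rewrite -yA tr_row [col j A^T]colE colE !mulmxA.
  rewrite mxE (bigD1 j) //= big1 ?addr0 => [|k kj].
    rewrite [col _ _ _ _]mxE => /eqP; rewrite mulf_eq0 => /orP[/eqP //|/eqP e].
    by have := orA j j; rewrite e !eqxx.
  by have := orA k j; rewrite [col _ _ _ _]mxE (negbTE kj) => /negbFE/eqP ->; rewrite mulr0.
rewrite -yA; have [->|/(unitriangular_top HA)[j [yj]]] := eqVneq y 0; first by rewrite mul0mx.
by rewrite yA => vj; have := yj; rewrite y0 ?eqxx //; apply: v_lt; rewrite vj.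
Qed.

End Unitriangular.

(** A statistic that increases strictly with the dominance order on partitions of [d], used to index
    unitriangularity. *)
Definition dom_stat (d : nat) (la : seq nat) : nat := \sum_(k < d.+1) sumn (take k la).

Lemma dominated_take nu la k : sumn nu = sumn la -> dominated nu la ->
  (sumn (take k nu) <= sumn (take k la))%N.
Proof.
move=> sE /allP h; case: (leqP k (size nu)) => kn.
  by apply: h; rewrite mem_iota.
rewrite take_oversize ?(ltnW kn) //.
have := h (size nu); rewrite mem_iota ltnSn take_size => /(_ isT) h'.
apply: leq_trans h' _.
by rewrite -(take_takel la (ltnW kn)) -{2}(cat_take_drop (size nu) (take k la)) sumn_cat leq_addr.
Qed.

Lemma dom_stat_lt d nu la : nu \in parts d -> la \in parts d -> la != nu ->
  (forall k, sumn (take k nu) <= sumn (take k la))%N ->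
  (dom_stat d nu < dom_stat d la)%N.
Proof.
rewrite !mem_parts => /andP[pn /eqP sn] /andP[pl /eqP sl] ne h.
have [k kne] : exists k : 'I_d.+1, sumn (take k nu) != sumn (take k la).
  apply/existsP; apply: contraNT ne; rewrite negb_exists => /forallP eqk.
  apply/eqP; have [pn0 pl0] := (proj2 (andP pn), proj2 (andP pl)).
  rewrite -(filter_pad d pn0) -(filter_pad d pl0); congr filter.
  have szn : (size nu <= d)%N by rewrite -sn size_part.
  have szl : (size la <= d)%N by rewrite -sl size_part.
  apply: eq_sumn_take => [|k]; first by rewrite !size_pad.
  rewrite !sumn_take_pad; case: (ltnP k d.+1) => kd.
    by have := eqk (Ordinal kd); rewrite negbK => /eqP.
  by rewrite !take_oversize ?sn ?sl // (leq_trans _ (ltnW kd)).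
rewrite /dom_stat (bigD1 k) //= [X in (_ < X)%N](bigD1 k) //= -addSn.
by apply: leq_add; [rewrite ltn_neqAle kne h | apply: leq_sum => i _; apply: h].
Qed.

Section AcoefTriangular.

Variables (K : fieldType) (z : K).
Hypothesis z_neq1 : forall n, 1 - z ^+ n.+1 != 0.

Lemma Acoef_diag d mu : mu \in parts d -> Acoef z d mu mu = 1.
Proof.
move=> pmu; have mv := pad_vecs pmu.
move: pmu; rewrite mem_parts => /andP[pmu /eqP sm].
have sz : (size mu <= d)%N by rewrite -sm size_part.
rewrite /Acoef /pad rev_cat rev_nseq Ah_nseq0 //; last first.
  by rewrite size_cat size_nseq subnKC // leqW.
by apply: Ah_diag; rewrite ?subnKC ?leqW //; case/andP: pmu.
Qed.

Lemma Acoef_dominated d mu nu : mu \in parts d -> Acoef z d mu nu != 0 ->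
  forall k, (sumn (take k nu) <= sumn (take k mu))%N.
Proof.
move=> pmu; have mv := pad_vecs pmu; rewrite /Acoef mulf_eq0 negb_or => /andP[_ Ak] k.
have [|_ h _] := @Ah_neq0 _ _ z_neq1 _ _ _ _ Ak; first by rewrite (size_vecs mv).
by have := h k; rewrite revK !sumn_take_pad.
Qed.

End AcoefTriangular.

Lemma mpart_seq n nu : (size nu <= n)%N -> (mpart n nu : seq nat) = pad n nu.
Proof.
move=> h; apply: (@eq_from_nth _ 0%N); first by rewrite size_tuple size_pad.
move=> i; rewrite size_tuple => hi.
by rewrite -(mnm_nth 0%N (mpart n nu) (Ordinal hi)) mnmE nth_pad.
Qed.

Lemma mcoeff_msymf (R : comNzRingType) d ka nu : ka \in parts d -> nu \in parts d ->
  (msymf R ka d)@_(mpart d nu) = (ka == nu)%:R.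
Proof.
rewrite !mem_parts => /andP[/andP[ks k0] /eqP sk] /andP[pn /eqP sn].
have [ns n0] := andP pn.
have sz : (size nu <= d)%N by rewrite -sn size_part.
have md : (mdeg (mpart d nu) < (sumn ka).+1)%N.
  suff -> : mdeg (mpart d nu) = d by rewrite sk.
  rewrite mdegE -[RHS]sn -(sumn_pad d) -mpart_seq // sumnE big_tuple.
  by apply: eq_bigr => i _; rewrite mnm_tnth.
rewrite raddf_sum /=.
under eq_bigr => m _ do rewrite mcoeffX.
rewrite big_mkcond (bigD1 (BMultinom md)) //= big1 ?addr0 => [|m nm]; last first.
  case: ifP => // _; case: eqP => // e.
  by case/eqP: nm; apply/val_inj.
rewrite eqxx mpart_seq // filter_pad //.
suff -> : perm_eq nu ka = (ka == nu) by case: eqP.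
apply/idP/eqP => [pe|-> //].
by apply/esym; apply: (sorted_eq geq_trans geq_anti).
Qed.

(** * Specialization of Macdonald polynomials at t = 0 *)

Lemma q_neq1 n : 1 - q ^+ n.+1 != 0.
Proof.
rewrite /q -tofracXn -tofrac1 -tofracB tofrac_eq0 subr_eq0 eq_sym.
by apply/eqP => /(congr1 (size \o polyseq)) /=; rewrite size_polyXn size_poly1.
Qed.

Lemma Qq_char0 n : n.+1%:R != 0 :> Qq.
Proof.
rewrite -(rmorph_nat (@FracField.tofrac {poly rat})) tofrac_eq0 -polyC_natr polyC_eq0.
by rewrite Num.Theory.pnatr_eq0.
Qed.

Section ValueAt0.

(* value_at_t0 is the case F = Q(q); over an abstract field, unification does  *)
(* not compute in Q(q).                                                        *)
Variable F : fieldType.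

Definition value_at0 (f : {fraction {poly F}}) (c : F) : Prop :=
  exists num den : {poly F},
    [/\ den.[0] != 0,
        f = @FracField.tofrac {poly F} num / @FracField.tofrac {poly F} den
      & c = num.[0] / den.[0]].

Definition emb : {rmorphism F -> {fraction {poly F}}} :=
  @FracField.tofrac {poly F} \o polyC.

Lemma value_at0_emb c : value_at0 (emb c) c.
Proof.
exists c%:P, 1; split; first by rewrite hornerC oner_eq0.
  by rewrite tofrac1 divr1.
by rewrite !hornerC divr1.
Qed.

Lemma horner_neq0 (p : {poly F}) x : p.[x] != 0 -> p != 0.
Proof. by apply: contraNneq => ->; rewrite horner0. Qed.

Lemma value_at0_add f c f' c' : value_at0 f c -> value_at0 f' c' ->
  value_at0 (f + f') (c + c').
Proof.
move=> [n [d [d0 -> ->]]] [n' [d' [d0' -> ->]]].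
exists (n * d' + n' * d), (d * d'); split.
- by rewrite hornerM mulf_neq0.
- have [e e'] : d != 0 /\ d' != 0.
    by split; [apply: horner_neq0 d0 | apply: horner_neq0 d0'].
  by rewrite tofracD !tofracM addf_div ?tofrac_eq0.
- by rewrite !(hornerD, hornerM) addf_div.
Qed.

Lemma value_at0_mul f c f' c' : value_at0 f c -> value_at0 f' c' ->
  value_at0 (f * f') (c * c').
Proof.
move=> [n [d [d0 -> ->]]] [n' [d' [d0' -> ->]]].
exists (n * n'), (d * d'); split.
- by rewrite hornerM mulf_neq0.
- by rewrite !tofracM mulf_div.
- by rewrite !hornerM mulf_div.
Qed.

Lemma value_at0_uniq f c c' : value_at0 f c -> value_at0 f c' -> c = c'.
Proof.
move=> [n [d [d0 fE ->]]] [n' [d' [d0' + ->]]]; rewrite {}fE => /eqP.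
have [e e'] : d != 0 /\ d' != 0.
  by split; [apply: horner_neq0 d0 | apply: horner_neq0 d0'].
rewrite eqr_div ?tofrac_eq0 // -!tofracM tofrac_eq => /eqP h.
by apply/eqP; rewrite eqr_div // -!hornerM h.
Qed.

Lemma value_at0_sum (I : Type) (r : seq I) (u : I -> {fraction {poly F}}) (v : I -> F) :
  (forall i, value_at0 (u i) (v i)) ->
  value_at0 (\sum_(i <- r) u i) (\sum_(i <- r) v i).
Proof.
move=> h; elim: r => [|i r IH]; last by rewrite !big_cons; apply: value_at0_add.
by rewrite !big_nil -(rmorph0 emb); apply: value_at0_emb.
Qed.

Lemma value_at0_ratio r (c : F) :
  value_at0 ((1 - @FracField.tofrac {poly F} c%:P ^+ r.+1) /
             (1 - @FracField.tofrac {poly F} 'X ^+ r.+1)) (1 - c ^+ r.+1).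
Proof.
exists (1 - c ^+ r.+1)%:P, (1 - 'X ^+ r.+1); split.
- by rewrite !hornerE expr0n subr0 oner_eq0.
- by rewrite -!tofracXn -!tofrac1 -!tofracB polyCB polyC_exp.
- by rewrite !hornerE expr0n subr0 divr1.
Qed.

End ValueAt0.

Lemma value_at0_zpart rho : 0%N \notin rho ->
  value_at0 (zpart_qt rho) (zq_coef q rho)^-1.
Proof.
move=> r0; rewrite /zpart_qt /zq_coef invrK; apply: value_at0_mul.
  by rewrite -(rmorph_nat (emb Qq)); apply: value_at0_emb.
elim: rho r0 => [|[|r] rho IH] //; rewrite ?big_nil.
  by rewrite -(rmorph1 (emb Qq)) => _; apply: value_at0_emb.
rewrite inE /= !big_cons => r0; apply: value_at0_mul; last exact: IH.
exact: value_at0_ratio.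
Qed.

Lemma map_psymf (K K' : comNzRingType) (f : {rmorphism K -> K'}) rho d :
  map_mpoly f (psymf K rho d) = psymf K' rho d.
Proof.
rewrite /psymf rmorph_prod; apply: eq_bigr => r _; rewrite rmorph_sum.
by apply: eq_bigr => i _; rewrite rmorphXn /= map_mpolyX.
Qed.

Lemma value_at0_0 (F : fieldType) : value_at0 (0 : {fraction {poly F}}) 0.
Proof. by rewrite -(rmorph0 (emb F)); apply: value_at0_emb. Qed.

(** * Gram matrices, and the characterization of [Acoef] by orthogonality *)

Section GramMatrix.

Variable d : nat.
Local Notation N := (size (parts d)).
Definition part_at (i : 'I_N) : seq nat := nth [::] (parts d) i.
Local Notation l := part_at.

Lemma part_at_mem i : l i \in parts d.
Proof. by rewrite mem_nth. Qed.

Lemma part_atP i : is_part (l i) /\ sumn (l i) = d.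
Proof. by have := part_at_mem i; rewrite mem_parts => /andP[? /eqP]. Qed.

Lemma part_at_eq i j : (l i == l j) = (i == j).
Proof. by rewrite nth_uniq ?uniq_parts. Qed.

Lemma part_at_onto la : la \in parts d -> exists i, l i = la.
Proof.
move=> pla; exists (Ordinal (etrans (index_mem la (parts d)) pla)).
by rewrite /part_at nth_index.
Qed.

Lemma big_part_at (V : nmodType) (G : seq nat -> V) :
  \sum_(rho <- parts d) G rho = \sum_i G (l i).
Proof. by rewrite (big_nth [::]) big_mkord. Qed.

Variables (K : fieldType) (z : K).
Hypothesis z_neq1 : forall n, 1 - z ^+ n.+1 != 0.
Hypothesis K_char0 : forall n, n.+1%:R != 0 :> K.

Definition psum_mx : 'M[K]_N := \matrix_(i, j) (psymf K (l i) d)@_(mpart d (l j)).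
Definition Acoef_mx : 'M[K]_N := \matrix_(i, j) Acoef z d (l i) (l j).

Local Notation A := Acoef_mx.
Local Notation R := psum_mx.
Let Bd := diag_mx (\row_i (Bq z (pad d.+1 (l i)))^-1).
Let Zd := diag_mx (\row_i zq_coef z (l i)).
Let Zi := diag_mx (\row_i (zq_coef z (l i))^-1).

Lemma gram_mx : A^T *m Bd *m A = R^T *m Zd *m R.
Proof.
have diagE n (X Y : 'M[K]_n) (b : 'rV_n) i j :
    (X^T *m diag_mx b *m Y) i j = \sum_k b 0 k * X k i * Y k j.
  rewrite mxE; apply: eq_bigr => k _; congr (_ * _).
  by rewrite mul_mx_diag !mxE mulrC.
apply/matrixP => i j; rewrite !diagE.
have := gram z_neq1 K_char0 (part_at_mem i) (part_at_mem j); rewrite !big_part_at => h.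
under eq_bigr => k _ do rewrite !mxE.
by under [RHS]eq_bigr => k _ do rewrite !mxE.
Qed.

Lemma unitriangular_Acoef : unitriangular (fun i => dom_stat d (l i)) A.
Proof.
have lP := part_at_mem.
move=> i j; rewrite !mxE (Acoef_diag z_neq1) //; split=> // Aij ij.
apply: dom_stat_lt => //; first by rewrite part_at_eq.
exact: (Acoef_dominated z_neq1 (lP i) Aij).
Qed.

(** In [gram_mx] the left side is invertible, as a product of unitriangular and diagonal matrices;
    hence so is the factor [R] on the right. *)
Lemma psum_mx_unit : R \in unitmx.
Proof.
have uB : Bd \in unitmx.
  rewrite unitmxE det_diag unitfE; apply/prodf_neq0 => i _.
  by rewrite mxE invr_eq0 Bq_neq0.
have : R^T *m Zd *m R \in unitmx.
  by rewrite -gram_mx !unitmx_mul unitmx_tr uB (unitriangular_unit unitriangular_Acoef).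
by rewrite unitmx_mul => /andP[].
Qed.

(** Row [i] of [C R^-1] holds coordinates in the power sums, so the second hypothesis is
    orthogonality for <,>_{q,0}; [M] is the matrix of this form in the monomial basis. *)
Lemma Acoef_unique (C : 'M[K]_N) :
  unitriangular (fun i => dom_stat d (l i)) C ->
  (forall i j, i != j -> \sum_k (C *m invmx R) i k * (C *m invmx R) j k
      * (zq_coef z (l k))^-1 = 0) ->
  C = A.
Proof.
move=> triC orC; have uA := unitriangular_unit unitriangular_Acoef.
pose M := invmx R *m Zi *m (invmx R)^T.
(* [M] inverts the matrix of [gram_mx]; therefore [A M A^T] is the inverse of [Bd], and the rows of
   [A] are orthogonal with nonzero norms. *)
have MR : M *m (R^T *m Zd *m R) = 1%:M.
  have RR : (invmx R)^T *m R^T = 1%:M by rewrite -trmx_mul mulmxV ?psum_mx_unit // trmx1.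
  have ZZ : Zi *m Zd = 1%:M.
    rewrite mulmx_diag -diag_const_mx; congr diag_mx; apply/rowP => i.
    by rewrite !mxE mulVf // zq_coef_neq0 //; case: (part_atP i) => /andP[].
  rewrite /M -!mulmxA (mulmxA _ R^T) RR mul1mx (mulmxA Zi) ZZ mul1mx.
  by rewrite mulVmx ?psum_mx_unit.
apply: (unitriangular_orthogonal (M := M) unitriangular_Acoef triC) => i j; last first.
  move=> /orC <-; set Y := C *m invmx R.
  have -> : C *m M *m C^T = Y *m Zi *m Y^T by rewrite /Y trmx_mul !mulmxA.
  rewrite mxE; apply: eq_bigr => k _.
  by rewrite mul_mx_diag [Y^T _ _]mxE mxE [(\row__ _) _ _]mxE mulrAC.
have : (A *m M *m A^T) *m Bd = 1%:M.
  rewrite -[LHS](mulmxK uA) -(mulmxA _ Bd A).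
  by rewrite -(mulmxA _ A^T) (mulmxA A^T) gram_mx -(mulmxA A) MR mulmx1 mulmxV.
move/matrixP => /(_ i j); rewrite mul_mx_diag mxE [(\row__ _) _ _]mxE [RHS]mxE.
have b0 : (Bq z (pad d.+1 (l j)))^-1 != 0 by rewrite invr_eq0 Bq_neq0.
case: eqP => _ /=.
  by move=> e; apply/eqP => e0; move/eqP: e; rewrite e0 mul0r eq_sym oner_eq0.
by move/eqP; rewrite mulf_eq0 (negbTE b0) orbF => /eqP ->; rewrite eqxx.
Qed.

End GramMatrix.

(** * Coefficients of the q-Whittaker functions *)

Lemma mcoeff_expand_msymf (R : comNzRingType) d (f : symfun R) u nu :
  expands_in (@msymf R) d f u -> nu \in parts d -> (f d)@_(mpart d nu) = u nu.
Proof.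
move=> fu pnu; rewrite fu raddf_sum /= (bigD1_seq nu) ?uniq_parts //=.
rewrite mcoeffZ mcoeff_msymf // eqxx mulr1 big_seq_cond big1 ?addr0 //.
move=> ka /andP[pka nk].
by rewrite mcoeffZ mcoeff_msymf // (negbTE nk) mulr0.
Qed.

(** The matrix from power sums to monomials and its inverse are free of t, so coordinates in the
    power sums are t-free combinations of monomial coefficients and acquire no pole. *)
Lemma value_at0_psymf_coef (K : fieldType) d (f : symfun {fraction {poly K}})
    cc (C : 'rV[K]_(size (parts d))) :
  expands_in (@psymf _) d f cc -> psum_mx d K \in unitmx ->
  (forall k, value_at0 (f d)@_(mpart d (part_at k)) (C 0 k)) ->
  forall k : 'I_(size (parts d)),
    value_at0 (cc (part_at k)) ((C *m invmx (psum_mx d K)) 0 k).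
Proof.
move=> Ecc uR fC k; set R := psum_mx d K.
pose U : 'rV_(size (parts d)) := \row_k (f d)@_(mpart d (part_at k)).
pose cr : 'rV_(size (parts d)) := \row_k cc (part_at k).
have UE : U = cr *m map_mx (emb K) R.
  apply/rowP => k'; rewrite [LHS]mxE [RHS]mxE Ecc raddf_sum big_part_at.
  apply: eq_bigr => r _.
  by rewrite /= mcoeffZ [cr _ _]mxE [map_mx _ _ _ _]mxE mxE -(map_psymf (emb K)) mcoeff_map_mpoly.
have -> : cc (part_at k) = \sum_k' U 0 k' * emb K (invmx R k' k).
  transitivity (cr 0 k); first by rewrite mxE.
  rewrite -[cr](@mulmxK _ _ _ (map_mx (emb K) R)) ?map_unitmx // -UE -map_invmx [LHS]mxE.
  by apply: eq_bigr => k' _; rewrite [map_mx _ _ _ _]mxE.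
rewrite mxE; apply: value_at0_sum => k'; apply: value_at0_mul; last exact: value_at0_emb.
by rewrite mxE; apply: fC.
Qed.

Lemma value_at0_1 (F : fieldType) : value_at0 (1 : {fraction {poly F}}) 1.
Proof. by rewrite -(rmorph1 (emb F)); apply: value_at0_emb. Qed.

Lemma qwhittaker_mcoeff W d la nu : is_qwhittaker W ->
  la \in parts d -> nu \in parts d ->
  (W la d)@_(mpart d nu) = Acoef q d la nu.
Proof.
move=> [P [[Ptri Porth] PW]] pla pnu.
pose N := size (parts d); pose l := @part_at d.
have lP i : l i \in parts d := part_at_mem i.
have lpart i : is_part (l i) /\ sumn (l i) = d := part_atP i.
have l_inj i j : (l i == l j) = (i == j) := part_at_eq i j.
have [[i0 <-] [j0 <-]] := (part_at_onto pla, part_at_onto pnu).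
pose C : 'M[Qq]_N := \matrix_(i, j) (W (l i) d)@_(mpart d (l j)).
suff : C = Acoef_mx d q by move/matrixP => /(_ i0 j0); rewrite [LHS]mxE [RHS]mxE.
pose R := psum_mx d Qq.
pose U i k := (P (l i) d)@_(mpart d (l k)).
have UC i k : value_at0 (U i k) (C i k).
  by rewrite mxE; apply: PW; case: (lpart i).
have triC : unitriangular (fun i => dom_stat d (l i)) C.
  move=> i j; have [pi si] := lpart i; have [u [Pu u1 udom]] := Ptri _ pi.
  rewrite si in Pu udom; have Uu k : U i k = u (l k) by apply: mcoeff_expand_msymf.
  split.
    by apply: value_at0_uniq (UC i i) _; rewrite Uu u1; apply: value_at0_1.
  move=> Cij ij; have uj : u (l j) != 0.
    apply: contraNneq Cij => u0; apply/eqP; apply: value_at0_uniq (UC i j) _.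
    by rewrite Uu u0; apply: value_at0_0.
  have [pj sj] := lpart j.
  apply: dom_stat_lt => // [|k]; first by rewrite l_inj.
  by apply: dominated_take => //; [rewrite si | apply: udom].
apply: (Acoef_unique q_neq1 Qq_char0 triC) => i j ij.
have [pi si] := lpart i; have [pj sj] := lpart j.
have [|c [c' [Ec Ec' v0]]] := Porth (l i) (l j) pi pj (etrans si (esym sj)).
  by apply/eqP; rewrite l_inj.
rewrite si in Ec Ec' v0.
have uR : R \in unitmx := psum_mx_unit d q_neq1 Qq_char0.
have coefE i' cc : expands_in (@psymf Qqt) d (P (l i')) cc ->
    forall k, value_at0 (cc (l k)) ((C *m invmx R) i' k).
  move=> Ecc k; have -> : (C *m invmx R) i' k = (row i' C *m invmx R) 0 k.
    by rewrite -row_mul [RHS]mxE.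
  by apply: (value_at0_psymf_coef Ecc uR) => k'; rewrite [row _ _ _ _]mxE; apply: UC.
(* The scalar product vanishes in Q(q,t); its value at t = 0, computed term by term, is the required
   sum. *)
apply: (value_at0_uniq (f := 0)); last exact: value_at0_0.
rewrite v0 big_part_at; apply: value_at0_sum => k.
apply: value_at0_mul; last by apply: value_at0_zpart; case: (lpart k) => /andP[].
by apply: value_at0_mul; apply: coefE.
Qed.

(** * Tableaux and chains of shapes *)

Lemma leq_sum_bool m (f : nat -> bool) : (\sum_(i < m) f i <= m)%N.
Proof.
rewrite -[X in (_ <= X)%N]card_ord -sum1_card leq_sum // => i _.
by case: (f i).
Qed.

Lemma count_prefix m (f : nat -> bool) :
  (forall j j', j <= j' < m -> f j' -> f j)%N ->
  forall j, (j < m)%N -> f j = (j < \sum_(i < m) f i)%N.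
Proof.
elim: m => // m IH fdec j; rewrite big_ord_recr /= ltnS => jm.
have Sm := leq_sum_bool m f.
case fm : (f m).
  rewrite (eq_bigr (fun=> 1%N)) => [|i _].
    by rewrite sum_nat_const card_ord muln1 addn1 ltnS jm (fdec j m) // jm ltnSn.
  by rewrite (fdec i m) // ltnSn andbT ltnW.
rewrite addn0; case: (ltnP j m) => jm'; first by apply: IH => // j1 j2 h; apply: fdec; lia.
have -> : j = m by apply/eqP; rewrite eqn_leq jm.
by rewrite fm ltnNge Sm.
Qed.

Lemma count_interval m a s : (s <= m)%N ->
  (\sum_(j < m | a <= j) (j < s))%N = (s - a)%N.
Proof.
move=> sm; rewrite -(big_mkord (fun j => a <= j)%N (fun j => (j < s) : nat)).
rewrite (big_cat_nat (n := s)) //= [X in (_ + X)%N]big_nat_cond [X in (_ + X)%N]big1 ?addn0.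
  rewrite -(card_ord (s - a)) -sum1_card; case: (leqP a s) => sa; last first.
    rewrite (eqP (ltnW sa)) big_ord0 big_nat_cond big1 //; lia.
  rewrite (big_cat_nat (n := a)) //= [X in (X + _)%N]big_nat_cond big1 ?add0n; last by lia.
  rewrite -{1}[a]add0n big_addn big_mkord; apply: eq_big => [j|j _]; first by rewrite leq_addl.
  by have jj := ltn_ord j; rewrite (_ : (j + a < s)%N) //; lia.
by move=> j /andP[/andP[sj _] _]; rewrite ltnNge sj.
Qed.

Section Tableaux.

Variables (mu nu : seq nat).
Hypothesis Hmu : is_part mu.
Local Notation n := (size nu).

Lemma part_nth_le i : (nth 0 mu i <= head 0 mu)%N.
Proof.
case: (ltnP i (size mu)) => h; last by rewrite nth_default.
rewrite -nth0; apply: (sorted_leq_nth geq_trans (leqnn : reflexive geq)) => //.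
- by case/andP: Hmu.
- by rewrite inE; apply: leq_ltn_trans h.
Qed.

Lemma part_nthS i : (nth 0 mu i.+1 <= nth 0 mu i)%N.
Proof.
case: (ltnP i.+1 (size mu)) => h; last by rewrite nth_default.
by apply: (sortedP 0%N (proj1 (andP Hmu))).
Qed.

Lemma part_nth_mono i i' : (i <= i')%N -> (nth 0 mu i' <= nth 0 mu i)%N.
Proof.
move=> /subnK <-; elim: (i' - i)%N => // k IH.
exact: leq_trans (part_nthS _) IH.
Qed.

Lemma col_lt (c : cell mu) : (col_of c < nth 0 mu (row_of c))%N.
Proof. exact: (valP c). Qed.

Lemma cell_at i j : (j < nth 0 mu i)%N ->
  exists c : cell mu, row_of c = i :> nat /\ col_of c = j :> nat.
Proof.
move=> h; have hi : (i < size mu)%N by rewrite ltnNge; apply/negP => le; rewrite nth_default in h.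
have hj : (j < head 0 mu)%N by apply: leq_trans h (part_nth_le i).
by exists (exist _ (Ordinal hi, Ordinal hj) h).
Qed.

Lemma big_cell (V : Type) (idx : V) (op : Monoid.com_law idx)
    (P : nat -> nat -> bool) (F : nat -> nat -> V) :
  \big[op/idx]_(c : cell mu | P (row_of c) (col_of c)) F (row_of c) (col_of c) =
  \big[op/idx]_(i < size mu) \big[op/idx]_(j < nth 0%N mu i | P i j) F i j.
Proof.
pose A := [pred c : 'I_(size mu) * 'I_(head 0%N mu) | (c.2 < nth 0%N mu c.1)%N].
transitivity (\big[op/idx]_(c in A | P c.1 c.2) F c.1 c.2).
  exact/esym/(big_sub_cond A (fun c => P c.1 c.2) (fun c => F c.1 c.2)).
rewrite -(pair_big_dep xpredT (fun i j => ((i, j) \in A) && P i j) (fun i j => F i j)) /=.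
apply: eq_bigr => i _.
rewrite (big_ord_widen_cond _ (P i) (F i) (part_nth_le i)).
by apply: eq_bigl => j; rewrite inE andbC.
Qed.

Section Entries.

Variable T : filling mu nu.

(** The sum has at most one term; it extends the filling by 0 to all positions, so that cells can be
    handled as pairs of numbers. *)
Definition entry (i j : nat) : nat :=
  (\sum_(c : cell mu | (row_of c == i :> nat) && (col_of c == j :> nat)) T c)%N.

Lemma entryE c : entry (row_of c) (col_of c) = T c.
Proof.
rewrite /entry (big_pred1 c) // => c' /=; apply/andP/eqP => [[/eqP er /eqP ec]|->] //.
Qed.

(** Length of row [i] of the shape formed by the entries below [k]: in a semistandard tableau these
    cells come first in their row ([entry_ltE]). *)
Definition shape_len (k i : nat) : nat :=
  (\sum_(j < nth 0%N mu i) (entry i j < k))%N.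

Lemma shape_len_le k i : (shape_len k i <= nth 0 mu i)%N.
Proof. exact: (leq_sum_bool _ (fun j => entry i j < k)%N). Qed.

Lemma entry_lt i j : (j < nth 0 mu i)%N -> (entry i j < n)%N.
Proof. by move=> /cell_at[c [<- <-]]; rewrite entryE. Qed.

Lemma shape_len_max i : shape_len n i = nth 0%N mu i.
Proof.
rewrite /shape_len -[RHS]card_ord -sum1_card; apply: eq_bigr => j _.
by rewrite entry_lt.
Qed.

Lemma shape_len0 i : shape_len 0 i = 0%N.
Proof. by rewrite /shape_len big1. Qed.

Hypothesis HT : T \in SSYT mu nu.

Lemma entry_row i j j' : (j <= j' < nth 0 mu i)%N -> (entry i j <= entry i j')%N.
Proof.
move=> /andP[jj jm]; have [c' [ri cj]] := cell_at jm.
have [c [ri' cj']] := cell_at (leq_ltn_trans jj jm).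
rewrite -{1}ri' -cj' -ri -cj !entryE.
move: HT; rewrite inE => /and3P[/forallP/(_ c)/forallP/(_ c')/implyP h _ _].
by apply: (implyP (h _)); rewrite -?val_eqE /= ?ri ?ri' ?cj ?cj'.
Qed.

Lemma entry_col i i' j : (i < i')%N -> (j < nth 0 mu i')%N -> (entry i j < entry i' j)%N.
Proof.
move=> ii jm; have [c' [ri cj]] := cell_at jm.
have [c [ri' cj']] := cell_at (leq_trans jm (part_nth_mono (ltnW ii))).
rewrite -{1}ri' -{1}cj' -ri -cj !entryE.
move: HT; rewrite inE => /and3P[_ /forallP/(_ c)/forallP/(_ c')/implyP h _].
by apply: (implyP (h _)); rewrite -?val_eqE /= ?ri ?ri' ?cj ?cj'.
Qed.

Lemma entry_ltE k i j : (j < nth 0 mu i)%N -> (entry i j < k)%N = (j < shape_len k i)%N.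
Proof.
apply: (count_prefix (f := fun j => entry i j < k)%N) => j1 j2 h.
exact: leq_ltn_trans (entry_row h).
Qed.

Lemma shape_len_mono k k' i : (k <= k')%N -> (shape_len k i <= shape_len k' i)%N.
Proof.
move=> kk; apply: leq_sum => j _.
by case: (ltnP (entry i j) k) => // /leq_trans/(_ kk) ->.
Qed.

(** Above the last cell of row [i.+1] with entry at most [k] stands a smaller entry. Successive
    shapes thus differ by a horizontal strip. *)
Lemma shape_len_inter k i : (shape_len k.+1 i.+1 <= shape_len k i)%N.
Proof.
case: (posnP (shape_len k.+1 i.+1)) => [->//|s0].
set j := (shape_len k.+1 i.+1).-1.
have jE : (shape_len k.+1 i.+1 = j.+1)%N by rewrite /j prednK.
have jm : (j < nth 0 mu i.+1)%N by rewrite -jE shape_len_le.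
have := entry_ltE k.+1 jm; rewrite jE ltnSn => /idP ek.
rewrite -entry_ltE; last exact: leq_trans jm (part_nthS i).
by have := entry_col (ltnSn i) jm; lia.
Qed.

Lemma shape_len_content k : (k < n)%N ->
  (\sum_(i < size mu) shape_len k i + nth 0 nu k = \sum_(i < size mu) shape_len k.+1 i)%N.
Proof.
move=> kn; move: HT; rewrite inE => /and3P[_ _ /forallP/(_ (Ordinal kn))/eqP /= <-].
rewrite -sum1dep_card (eq_bigl (fun c => entry (row_of c) (col_of c) == k)); last first.
  by move=> c; rewrite entryE -val_eqE.
rewrite (big_cell _ (fun i j => entry i j == k) (fun _ _ => 1%N)) /= -big_split /=.
apply: eq_bigr => i _; rewrite /shape_len [X in (_ + X)%N]big_mkcond -big_split /=; apply: eq_bigr => j _.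
by rewrite ltnS [in RHS]leq_eqVlt; case: ltngtP.
Qed.

Lemma betaE k (i : 'I_(size mu)) : beta T k i = (shape_len k.+1 i - shape_len k i)%N.
Proof.
rewrite /beta -sum1dep_card.
rewrite (eq_bigl (fun c => (entry (row_of c) (col_of c) == k) && (row_of c == i :> nat))); last first.
  by move=> c; rewrite entryE.
rewrite (big_cell _ (fun i' j => (entry i' j == k) && (i' == i)) (fun _ _ => 1%N)) /=.
rewrite (bigD1 i) //= [X in (_ + X)%N]big1 ?addn0 => [|i' ne]; last first.
  by rewrite big1 // => j /andP[_ /eqP/val_inj e]; rewrite e eqxx in ne.
apply/eqP; rewrite -(eqn_add2r (shape_len k i)) subnK ?shape_len_mono //.
rewrite /shape_len big_mkcond -big_split /=; apply/eqP; apply: eq_bigr => j _.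
by rewrite eqxx andbT ltnS [in RHS]leq_eqVlt; case: ltngtP.
Qed.

(** The entries of the row above that are smaller than [T c] form an initial segment, of which the
    columns from [col_of c] on are counted. *)
Lemma r_cellE c : (0 < row_of c)%N ->
  r_cell T c = (shape_len (T c) (row_of c).-1 - col_of c)%N.
Proof.
move=> r0; rewrite /r_cell -sum1dep_card.
pose P i j := [&& i.+1 == row_of c :> nat, (col_of c <= j)%N & (entry i j < T c)%N].
rewrite (eq_bigl (fun c' => P (row_of c') (col_of c'))); last first.
  by move=> c'; rewrite /P entryE.
rewrite (big_cell _ P (fun _ _ => 1%N)) /=.
have rm : ((row_of c).-1 < size mu)%N by have := ltn_ord (row_of c); lia.
rewrite (bigD1 (Ordinal rm)) //= [X in (_ + X)%N]big1 ?addn0 => [|i ne]; last first.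
  rewrite big1 // => j /and3P[/eqP e _ _]; case/eqP: ne; apply/val_inj => /=; lia.
rewrite -(count_interval _ (shape_len_le (T c) (row_of c).-1)).
rewrite big_mkcond [RHS]big_mkcond; apply: eq_bigr => j _.
rewrite /P prednK // eqxx /= entry_ltE //.
by case: (_ <= _)%N => //=; case: (_ < _)%N.
Qed.

End Entries.

Lemma shape_len_inj (T T' : filling mu nu) : T \in SSYT mu nu -> T' \in SSYT mu nu ->
  (forall k i, k <= n -> shape_len T k i = shape_len T' k i)%N -> T = T'.
Proof.
move=> HT HT' h; apply/ffunP => c; apply/val_inj => /=.
have eqlt k : (k <= n)%N -> (T c < k)%N = (T' c < k)%N.
  by move=> kn; rewrite -!entryE !entry_ltE ?col_lt // h.
have h1 := eqlt _ (ltn_ord (T c)); have h2 := eqlt _ (ltn_ord (T' c)).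
by move: h1 h2; rewrite !ltnS !leqnn => h1 h2; apply/eqP; rewrite eqn_leq h2 -h1.
Qed.

(* The tableau whose cells with entry less than k form the shape K k. *)
Lemma shape_len_surj (K : nat -> nat -> nat) :
  (forall i, K 0 i = 0)%N -> (forall i, K n i = nth 0 mu i)%N ->
  (forall k i, k < n -> K k i <= K k.+1 i)%N ->
  (forall k i, k < n -> K k.+1 i.+1 <= K k i)%N ->
  (forall k, k < n -> \sum_(i < size mu) K k i + nth 0 nu k = \sum_(i < size mu) K k.+1 i)%N ->
  exists2 T : filling mu nu, T \in SSYT mu nu &
    (forall k i, k <= n -> shape_len T k i = K k i)%N.
Proof.
move=> K0 Kn Kmono Kint Kc.
have Kle k k' i : (k <= k' <= n)%N -> (K k i <= K k' i)%N.
  move=> /andP[/subnK <-]; elim: (k' - k)%N => // m IH hn.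
  by apply: leq_trans (IH _) (Kmono _ _ _); lia.
(* The entry of a cell is the number of shapes among [K 1], ..., [K n] that do not contain it. *)
pose t (c : cell mu) := (\sum_(k < n) (K k.+1 (row_of c) <= col_of c))%N.
have tE c k : (k <= n)%N -> (t c < k)%N = (col_of c < K k (row_of c))%N.
  case: k => [|k] kn; first by rewrite K0.
  have pre : (K k.+1 (row_of c) <= col_of c)%N = (k < t c)%N.
    apply: (@count_prefix n (fun j => K j.+1 (row_of c) <= col_of c)%N) => // j j' h.
    by apply: leq_trans; apply: Kle; lia.
  by rewrite ltnS [RHS]ltnNge pre -leqNgt.
have tn c : (t c < n)%N by rewrite tE // Kn col_lt.
pose T : filling mu nu := [ffun c => Ordinal (tn c)].
have TE c : T c = t c :> nat by rewrite ffunE.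
have eE i j k : (k <= n)%N -> (j < nth 0 mu i)%N -> (entry T i j < k)%N = (j < K k i)%N.
  by move=> kn /cell_at[c [<- <-]]; rewrite entryE TE tE.
have sE k i : (k <= n)%N -> shape_len T k i = K k i.
  move=> kn; have Kmu : (K k i <= nth 0 mu i)%N by rewrite -Kn Kle // kn leqnn.
  rewrite -[RHS]subn0 -(count_interval 0 Kmu); apply: eq_bigr => j _.
  by rewrite eE.
exists T => //; rewrite inE; apply/and3P; split.
- apply/forallP => c; apply/forallP => c'; apply/implyP => /eqP er; apply/implyP => cc.
  rewrite !TE -ltnS tE; last exact: tn.
  by apply: leq_ltn_trans cc _; rewrite er -tE // tn.
- apply/forallP => c; apply/forallP => c'; apply/implyP => /eqP ec; apply/implyP => rr.
  rewrite !TE tE; last exact: ltnW (tn _).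
  have : (t c' < (t c').+1)%N by []. rewrite tE ?tn // ec => /leq_trans; apply.
  (* Interlacing puts the cell just above [c'] into the shape at level [t c']; the rows of this
     shape decrease, which reaches the row of [c]. *)
  case: (nat_of_ord (row_of c')) rr => // r; rewrite ltnS => rr.
  apply: leq_trans (Kint _ _ (tn _)) _.
  rewrite -(subnK rr); elim: (r - row_of c)%N => // m IH; apply: leq_trans IH.
  case tc : (t c') => [|s]; first by rewrite !K0.
  have sn : (s < n)%N by have := tn c'; lia.
  by rewrite addSn; apply: leq_trans (Kint _ _ sn) (Kmono _ _ sn).
apply/forallP => k; apply/eqP; have := Kc k (ltn_ord k) => h.
rewrite -[RHS](addKn (\sum_(i < size mu) K k i)%N) h.
rewrite -sum1dep_card (eq_bigl (fun c => entry T (row_of c) (col_of c) == k)); last first.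
  by move=> c; rewrite entryE -val_eqE.
rewrite (big_cell _ (fun i j => entry T i j == k) (fun _ _ => 1%N)) /=.
apply/eqP; rewrite -(eqn_add2l (\sum_(i < size mu) K k i)%N) subnKC ?leq_sum //; last first.
  by move=> i _; apply: Kmono.
rewrite -big_split /=; apply/eqP; apply: eq_bigr => i _.
rewrite -!sE ?(ltnW (ltn_ord k)) // /shape_len [X in (_ + X)%N]big_mkcond -big_split /=.
by apply: eq_bigr => j _; rewrite ltnS [in RHS]leq_eqVlt; case: ltngtP.
Qed.

End Tableaux.

Lemma sumn_nth p v : (forall i, p <= i -> nth 0 v i = 0)%N ->
  sumn v = (\sum_(i < p) nth 0%N v i)%N.
Proof.
elim: p v => [|p IH] v h.
  rewrite big_ord0; apply/eqP; rewrite -leqn0.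
  by apply: (@leq_sumn_nth v [::]) => i; rewrite h.
case: v h => [|a v] h; first by rewrite big1 // => i _; rewrite nth_nil.
by rewrite big_ord_recl /= (IH v) // => i pi; apply: (h i.+1).
Qed.

Lemma big_uniq_sub (V : nmodType) (I : eqType) (r s : seq I) (F : I -> V) :
  uniq r -> uniq s -> {subset r <= s} ->
  (forall i, i \in s -> i \notin r -> F i = 0) ->
  \sum_(i <- s) F i = \sum_(i <- r) F i.
Proof.
move=> ur us rs F0; rewrite (bigID (mem r)) /= [X in _ + X]big_seq_cond [X in _ + X]big1 ?addr0.
  rewrite -big_filter; apply: perm_big; apply: uniq_perm => //; first exact: filter_uniq.
  by move=> i; rewrite mem_filter /= andb_idr // => /rs.
by move=> i /andP[si ri]; apply: F0.
Qed.

Fixpoint lists (I : Type) (s : seq I) (m : nat) : seq (seq I) :=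
  if m is m'.+1 then [seq a :: c | a <- s, c <- lists s m'] else [:: [::]].

Lemma mem_lists (I : eqType) (s : seq I) m c :
  (c \in lists s m) = (size c == m) && all (mem s) c.
Proof.
elim: m c => [|m IH] c; first by case: c.
apply/allpairsP/idP => [[[a u] [as_ +] ->]|] /=.
  by rewrite IH => /andP[su uD]; rewrite eqSS su uD andbT.
case: c => // a c /=; rewrite eqSS => /and3P[sc as_ ca].
by exists (a, c); split=> //; rewrite IH sc.
Qed.

Lemma uniq_lists (I : eqType) (s : seq I) m : uniq s -> uniq (lists s m).
Proof.
move=> us; elim: m => // m IH; apply: allpairs_uniq => //.
by move=> [a u] [b v] _ _ /= [-> ->].
Qed.

(** * Sums over chains, and strip weights in q-factorials *)

Section ChainExpansion.

Variables (K : fieldType) (z : K).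
Hypothesis z_neq1 : forall n, 1 - z ^+ n.+1 != 0.
Local Notation qpoch := (qpoch z).
Local Notation ih := (ih z).
Local Notation Om := (Om z).
Local Notation Bq := (Bq z).

(** The list [ch] runs from the outermost shape inwards, without [mu] itself. Lists that are not
    chains with strip sizes [w] ending in the empty shape get weight 0. *)
Definition chain_weight (mu w : seq nat) (ch : seq (seq nat)) : K :=
  (\prod_(j < size w)
    (if (sumn (nth [::] ch j) + nth 0 w j == sumn (nth [::] (mu :: ch) j))%N
     then Om (nth [::] (mu :: ch) j) (nth [::] ch j) * Bq (nth [::] ch j) else 0))
  * (sumn (nth [::] (mu :: ch) (size w)) == 0%N)%:R.

Lemma Ah_chains D L mu w : size mu = L ->
  Ah z D mu w = \sum_(ch <- lists (vecs D L) (size w)) chain_weight mu w ch.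
Proof.
elim: w mu => [|r w IH] mu sm.
  by rewrite big_seq1 /chain_weight big_ord0 mul1r.
rewrite /= sm big_allpairs_dep [LHS]big_mkcond [LHS]big_seq [RHS]big_seq.
apply: eq_bigr => ka /size_vecs sk.
under [RHS]eq_bigr => ch _ do rewrite /chain_weight big_ord_recl /= -mulrA.
by rewrite -big_distrr /= IH //; case: ifP; rewrite ?mul0r.
Qed.

(** [gint] and [gfact] are [qint] and [qfact] over an arbitrary field; for [z] equal to [q] they are
    convertible to them. *)
Definition gint n : K := \sum_(i < n) z ^+ i.
Definition gfact n : K := \prod_(i < n) gint i.+1.

Lemma gfactS n : gfact n.+1 = gfact n * gint n.+1.
Proof. by rewrite /gfact big_ord_recr. Qed.

Lemma gfact0 : gfact 0 = 1.
Proof. by rewrite /gfact big_ord0. Qed.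

Lemma gintE n : (1 - z) * gint n = 1 - z ^+ n.
Proof. by rewrite -opprB mulNr -subrX1 opprB. Qed.

Lemma qpoch_gfact n : qpoch n = (1 - z) ^+ n * gfact n.
Proof.
elim: n => [|n IH]; first by rewrite qpoch0 gfact0 mulr1.
by rewrite qpochS IH gfactS -gintE exprS; ring.
Qed.

Lemma gfact_neq0 n : gfact n != 0.
Proof. by have := qpoch_neq0 z_neq1 n; rewrite qpoch_gfact mulf_eq0 negb_or => /andP[]. Qed.

Lemma one_sub_z : 1 - z != 0.
Proof. exact: (z_neq1 0). Qed.

Lemma gfact_interval s a b : (a <= b <= s)%N ->
  \prod_(a <= j < b) gint (s - j) = gfact (s - a) / gfact (s - b).
Proof.
move=> /andP[ab bs]; elim: b ab bs => [|b IH] ab bs.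
  by move: ab; rewrite leqn0 => /eqP ->; rewrite big_geq // divff ?gfact_neq0.
case: (ltngtP a b.+1) ab => // [|-> _]; last by rewrite big_geq // divff ?gfact_neq0.
rewrite ltnS => ab _; rewrite big_nat_recr //= IH // ?(ltnW bs) //.
have -> : (s - b = (s - b.+1).+1)%N by lia.
rewrite gfactS; have h1 := gfact_neq0 (s - b.+1); have h2 := gfact_neq0 (s - b).
have h3 : gint (s - b.+1).+1 != 0.
  have := gfact_neq0 (s - b.+1).+1; rewrite gfactS mulf_eq0 negb_or => /andP[] //.
by field; rewrite h1 h3.
Qed.

Fixpoint strip_weight (la ka : seq nat) : K :=
  match la, ka with
  | a :: la', b :: ka' =>
      gfact (b - head 0%N ka') / (gfact (a - b) * gfact (b - head 0%N la'))
      * strip_weight la' ka'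
  | _, _ => 1
  end.

Lemma strip_weight_prod la ka : size la = size ka ->
  strip_weight la ka = \prod_(i < size la)
    (gfact (nth 0 ka i - nth 0 ka i.+1)
     / (gfact (nth 0 la i - nth 0 ka i) * gfact (nth 0 ka i - nth 0 la i.+1))).
Proof.
elim: la ka => [|a la IH] [|b ka] //=; first by rewrite big_ord0.
by move=> [sz]; rewrite big_ord_recl /= !nth0 IH.
Qed.

(** Replacing (z;z)_n by [n]! costs (1 - z)^n. The exponents from [Om la ka] add up to la_1, those
    from [Bq ka] to ka_1, so these powers telescope along a chain. *)
Lemma Om_Bq_strip la ka : size la = size ka -> Om la ka != 0 ->
  (1 - z) ^+ head 0%N la * (Om la ka * Bq ka) = (1 - z) ^+ head 0%N ka * strip_weight la ka.
Proof.
elim: la ka => [|a la IH] [|b ka] //= => [_ _|[sz]]; first by rewrite !mulr1.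
move=> om; have [_ srt] := Om_neq0_sorted z_neq1 (congr1 S sz : size (a :: la) = size (b :: ka)) om.
move: om; rewrite !mulf_eq0 !negb_or !ih_neq0 // => /andP[/andP[ba lab] omn].
have kab : (head 0%N ka <= b)%N by case: (ka) srt => //= c v /andP[].
rewrite !ih_le // !qpoch_gfact.
have -> : (1 - z) ^+ a = (1 - z) ^+ (a - b) * (1 - z) ^+ (b - head 0%N la) * (1 - z) ^+ head 0%N la.
  by rewrite -!exprD; congr (_ ^+ _); lia.
have -> : (1 - z) ^+ b = (1 - z) ^+ (b - head 0%N ka) * (1 - z) ^+ head 0%N ka.
  by rewrite -!exprD; congr (_ ^+ _); lia.
have := IH _ sz omn.
set u1 := (1 - z) ^+ (a - b); set u2 := (1 - z) ^+ (b - head 0%N la).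
set u3 := (1 - z) ^+ (b - head 0%N ka); set g1 := gfact (a - b); set g2 := gfact (b - head 0%N la).
set g3 := gfact (b - head 0%N ka) => e.
have [n1 n2] : u1 != 0 /\ u2 != 0 by rewrite !expf_neq0 ?one_sub_z.
have [m1 m2] : g1 != 0 /\ g2 != 0 by rewrite !gfact_neq0.
transitivity ((1 - z) ^+ head 0%N la * (Om la ka * Bq ka) * (u3 * g3) / (g1 * g2)).
  by field; rewrite n1 n2 m1 m2.
by rewrite e; field; rewrite m1 m2.
Qed.

End ChainExpansion.

(** * The weight of a tableau as the weight of its chain *)

Section TableauWeights.

Variables (mu nu : seq nat).
Hypothesis Hmu : is_part mu.
Local Notation n := (size nu).
Local Notation L := (sumn mu).+1.

Definition shape_seq (T : filling mu nu) (k : nat) : seq nat := mkseq (shape_len T k) L.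

Definition shape_chain (T : filling mu nu) : seq (seq nat) :=
  mkseq (fun j => shape_seq T (n - j.+1)) n.

Lemma nth_shape_seq T k i : nth 0%N (shape_seq T k) i = shape_len T k i.
Proof.
case: (ltnP i L) => h; first by rewrite nth_mkseq.
rewrite nth_default ?size_mkseq //; apply/esym/eqP; rewrite -leqn0.
apply: leq_trans (shape_len_le T k i) _; rewrite leqn0 nth_default //.
by apply: leq_trans (size_part Hmu) _; lia.
Qed.

Lemma shape_seq_max T : shape_seq T n = pad L mu.
Proof.
have szL : (size mu <= L)%N by rewrite leqW // size_part.
apply: (@eq_from_nth _ 0%N); first by rewrite size_mkseq size_pad.
by move=> i _; rewrite nth_shape_seq nth_pad shape_len_max.
Qed.

Lemma nth_shape_chain T j : (j <= n)%N ->
  nth [::] (pad L mu :: shape_chain T) j = shape_seq T (n - j).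
Proof.
case: j => [|j] jn; first by rewrite subn0 shape_seq_max.
by rewrite /= nth_mkseq.
Qed.

Lemma sumn_shape_seq T k : sumn (shape_seq T k) = (\sum_(i < size mu) shape_len T k i)%N.
Proof.
rewrite (@sumn_nth (size mu)) => [|i hi].
  by apply: eq_bigr => i _; rewrite nth_shape_seq.
apply/eqP; rewrite nth_shape_seq -leqn0; apply: leq_trans (shape_len_le T k i) _.
by rewrite nth_default.
Qed.

Lemma shape_seq_vecs T k : shape_seq T k \in vecs (sumn mu) L.
Proof.
rewrite mem_vecs size_mkseq eqxx; apply/(all_nthP 0%N) => i _.
rewrite nth_shape_seq; apply: leq_trans (shape_len_le T k i) _.
case: (ltnP i (size mu)) => h; last by rewrite nth_default.
by apply: leq_sumn_mem; rewrite mem_nth.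
Qed.

Variables (K : fieldType) (z : K).
Hypothesis z_neq1 : forall n, 1 - z ^+ n.+1 != 0.
Local Notation Om := (Om z).
Local Notation Bq := (Bq z).
Local Notation gfact := (gfact z).
Local Notation gint := (gint z).

Lemma Om_neq0_inter la ka : size la = size ka ->
  (forall i, nth 0 ka i <= nth 0 la i)%N -> (forall i, nth 0 la i.+1 <= nth 0 ka i)%N ->
  Om la ka != 0.
Proof.
elim: la ka => [|a la IH] [|b ka] //=; first by rewrite oner_eq0.
move=> [sz] h1 h2; have := h1 0%N; have := h2 0%N => /= h20 h10.
apply: mulf_neq0; last by apply: (IH _ sz) => i; [exact: (h1 i.+1) | exact: (h2 i.+1)].
by apply: mulf_neq0; rewrite ih_neq0 // -nth0.
Qed.

Definition r_weight (T : filling mu nu) : K :=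
  \prod_(c : cell mu | (0 < row_of c)%N) gint (r_cell T c).

Definition s_weight (T : filling mu nu) : K :=
  \prod_(k < n) (gfact (nth 0%N nu k) /
     \prod_(b <- [seq beta T k j | j <- enum 'I_(size mu)]) gfact b).

Section OneTableau.

Variable T : filling mu nu.
Hypothesis HT : T \in SSYT mu nu.
Local Notation s := (shape_len T).

Lemma chain_weight_shape :
  chain_weight z (pad L mu) (rev nu) (shape_chain T) =
  \prod_(k < n) (Om (shape_seq T k.+1) (shape_seq T k) * Bq (shape_seq T k)).
Proof.
rewrite /chain_weight size_rev nth_shape_chain // subnn sumn_shape_seq.
rewrite [(\sum_(i < size mu) _)%N]big1 => [|i _]; last exact: shape_len0.
rewrite eqxx mulr1.
rewrite (reindex_inj rev_ord_inj) /=; apply: eq_bigr => k _; have kn := ltn_ord k.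
rewrite -[nth [::] (shape_chain T) _]/(nth [::] (pad L mu :: shape_chain T) (n - k.+1).+1).
rewrite !nth_shape_chain; try by lia.
have -> : (n - (n - k.+1).+1 = k)%N by lia.
have -> : (n - (n - k.+1) = k.+1)%N by lia.
rewrite nth_rev; last by lia.
have -> : (n - (n - k.+1).+1 = k)%N by lia.
by rewrite !sumn_shape_seq shape_len_content // eqxx.
Qed.

Lemma chain_weight_strips :
  (1 - z) ^+ head 0%N mu * chain_weight z (pad L mu) (rev nu) (shape_chain T) =
  \prod_(k < n) strip_weight z (shape_seq T k.+1) (shape_seq T k).
Proof.
rewrite chain_weight_shape -nth0 -(shape_len_max Hmu T).
suff tele k : (1 - z) ^+ s k 0 *
    \prod_(k' < k) (Om (shape_seq T k'.+1) (shape_seq T k') * Bq (shape_seq T k')) =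
    \prod_(k' < k) strip_weight z (shape_seq T k'.+1) (shape_seq T k') by exact: tele.
elim: k => [|k IH]; first by rewrite shape_len0 !big_ord0 mulr1.
rewrite !big_ord_recr /= -IH -!(nth_shape_seq T) !nth0 mulrCA.
have om : Om (shape_seq T k.+1) (shape_seq T k) != 0.
  apply: Om_neq0_inter => [|i|i]; rewrite ?size_mkseq ?nth_shape_seq //.
    exact: shape_len_mono.
  exact: shape_len_inter.
by rewrite (Om_Bq_strip z_neq1 _ om) ?size_mkseq // mulrCA mulrA.
Qed.

Lemma strip_weight_shape k :
  strip_weight z (shape_seq T k.+1) (shape_seq T k) =
  \prod_(i < size mu) (gfact (s k i - s k i.+1)
     / (gfact (s k.+1 i - s k i) * gfact (s k i - s k.+1 i.+1))).
Proof.
rewrite strip_weight_prod ?size_mkseq //.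
under eq_bigr => i _ do rewrite !nth_shape_seq.
have szL : (size mu <= L)%N by rewrite leqW // size_part.
rewrite (big_ord_widen _ (fun i => gfact (s k i - s k i.+1)
     / (gfact (s k.+1 i - s k i) * gfact (s k i - s k.+1 i.+1))) szL).
rewrite [RHS]big_mkcond; apply: eq_bigr => i _; case: (ltnP i (size mu)) => // h.
have s0 k' i' : (size mu <= i')%N -> s k' i' = 0%N.
  move=> h'; apply/eqP; rewrite -leqn0; apply: leq_trans (shape_len_le T k' i') _.
  by rewrite nth_default.
by rewrite !s0 ?(leqW h) // !subn0 !gfact0 mulr1 divr1.
Qed.

(** The cells of row [i.+1] with entry [k] are those in columns from [s k i.+1] up to but excluding
    [s k.+1 i.+1], all compared with the same length [s k i]; [gfact_interval] multiplies their
    q-integers. *)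
Lemma r_weight_row i :
  \prod_(j < nth 0%N mu i.+1) gint (s (entry T i.+1 j) i - j) =
  \prod_(k < n) (gfact (s k i - s k i.+1) / gfact (s k i - s k.+1 i.+1)).
Proof.
rewrite -(shape_len_max Hmu T) -(big_mkord xpredT (fun j => gint (s (entry T i.+1 j) i - j))).
suff part k : (k <= n)%N -> \prod_(0 <= j < s k i.+1) gint (s (entry T i.+1 j) i - j) =
    \prod_(k' < k) (gfact (s k' i - s k' i.+1) / gfact (s k' i - s k'.+1 i.+1)).
  exact: part.
elim: k => [|k IH] kn; first by rewrite shape_len0 big_ord0 big_geq.
rewrite big_ord_recr /= -IH ?(ltnW kn) //.
rewrite (big_cat_nat (n := s k i.+1)) //=; last exact: shape_len_mono.
congr (_ * _); rewrite -gfact_interval //; last by rewrite shape_len_mono ?shape_len_inter.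
apply: eq_big_nat => j /andP[kj jk].
have jm : (j < nth 0 mu i.+1)%N by apply: leq_trans jk (shape_len_le T _ _).
have -> // : entry T i.+1 j = k.
have e1 : (entry T i.+1 j < k.+1)%N by rewrite entry_ltE.
have e2 : ~~ (entry T i.+1 j < k)%N by rewrite entry_ltE // -leqNgt.
lia.
Qed.

Lemma r_weightE : r_weight T =
  \prod_(i < size mu) \prod_(k < n)
     (gfact (s k i - s k i.+1) / gfact (s k i - s k.+1 i.+1)).
Proof.
under [RHS]eq_bigr => i _ do rewrite -r_weight_row.
pose F i j := gint (s (entry T i j) i.-1 - j).
rewrite /r_weight (eq_bigr (fun c => F (row_of c) (col_of c))); last first.
  by move=> c r0; rewrite /F r_cellE // entryE.
rewrite (big_cell Hmu _ (fun i _ => (0 < i)%N) F) /=.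
case E : (size mu) => [|p]; first by rewrite !big_ord0.
(* The top row contributes nothing on the left, and the row below the last is empty on the right;
   the remaining indices differ by one. *)
rewrite big_ord_recl [RHS]big_ord_recr /= big_pred0 // mul1r.
have -> : nth 0%N mu p.+1 = 0%N by rewrite nth_default ?E.
by rewrite big_ord0 mulr1.
Qed.

(** For each entry the q-multinomial supplies [nu_k]! and the denominators [la_i - ka_i]!, and
    [r_weightE] the other factorials of the strip weight. *)
Lemma tableau_weight : r_weight T * s_weight T =
  (\prod_(k < n) gfact (nth 0%N nu k)) *
  ((1 - z) ^+ head 0%N mu * chain_weight z (pad L mu) (rev nu) (shape_chain T)).
Proof.
rewrite chain_weight_strips r_weightE exchange_big -!big_split.
apply: eq_bigr => k _; rewrite [LHS]/= strip_weight_shape big_map big_enum.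
under [X in _ / X]eq_bigr => i _ do rewrite betaE //.
rewrite mulrCA; congr (_ * _); rewrite -prodf_div; apply: eq_bigr => i _.
have h1 := gfact_neq0 z_neq1 (s k.+1 i - s k i).
have h2 := gfact_neq0 z_neq1 (s k i - s k.+1 i.+1).
by field; rewrite h1 h2.
Qed.

End OneTableau.

(** [shape_chain] is a bijection from the tableaux onto a set of lists containing all those of
    nonzero weight. *)
Lemma sum_tableau_weights : sumn nu = sumn mu ->
  \sum_(T in SSYT mu nu) r_weight T * s_weight T =
  (\prod_(k < n) gfact (nth 0%N nu k)) *
  ((1 - z) ^+ head 0%N mu * Ah z (sumn mu) (pad L mu) (rev nu)).
Proof.
move=> sE; have szL : (size mu <= L)%N by rewrite leqW // size_part.
rewrite (eq_bigr _ (fun T HT => tableau_weight HT)) -!big_distrr /=.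
congr (_ * (_ * _)); rewrite (@Ah_chains _ _ (sumn mu) L) ?size_pad // size_rev.
rewrite -big_enum -(big_map shape_chain xpredT); apply/esym/big_uniq_sub.
- rewrite map_inj_in_uniq ?enum_uniq // => T T'; rewrite !mem_enum => HT HT' e.
  apply: (shape_len_inj Hmu HT HT') => k i kn.
  rewrite -!nth_shape_seq -{1}(subKn kn) -[in RHS](subKn kn).
  by rewrite -!nth_shape_chain ?leq_subr // e.
- exact/uniq_lists/uniq_vecs.
- move=> _ /mapP[T _ ->]; rewrite mem_lists size_mkseq eqxx.
  apply/(all_nthP [::]) => j; rewrite size_mkseq => jn.
  by rewrite nth_mkseq //; apply: shape_seq_vecs.
move=> ch; rewrite mem_lists => /andP[/eqP sch /allP chv].
apply: contraNeq => nz; apply/mapP.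
(* [ch] read from the inside out, with [mu] restored at level [n]. Nonzero weight gives the sizes
   and the interlacing that [shape_len_surj] needs. *)
pose Kl k := nth [::] (pad L mu :: ch) (n - k).
have Kl_size k : size (Kl k) = L.
  rewrite /Kl; case: (n - k)%N (leq_subr k n) => [|j] jn; first by rewrite /= size_pad.
  have /chv : nth [::] ch j \in ch by rewrite mem_nth // sch.
  exact: size_vecs.
have step k : (k < n)%N ->
    (sumn (Kl k) + nth 0 nu k)%N = sumn (Kl k.+1) /\ Om (Kl k.+1) (Kl k) != 0.
  move=> kn; move: nz; rewrite /chain_weight mulf_eq0 negb_or size_rev => /andP[+ _].
  have jn : (n - k.+1 < n)%N by lia.
  move=> /prodf_neq0/(_ (Ordinal jn) isT) /=.
  rewrite -[nth [::] ch _]/(nth [::] (pad L mu :: ch) (n - k.+1).+1) subnSK // nth_rev //.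
  have -> : (n - (n - k.+1).+1 = k)%N by lia.
  rewrite -/(Kl k) -/(Kl k.+1); case: ifP => [/eqP ->|_]; last by rewrite eqxx.
  by rewrite mulf_eq0 negb_or => /andP[-> _].
have Kl0 : sumn (Kl 0) = 0%N.
  move: nz; rewrite /chain_weight mulf_eq0 negb_or size_rev => /andP[_].
  by rewrite /Kl subn0; case: (_ =P 0%N) => // _; rewrite eqxx.
have Kln : Kl n = pad L mu by rewrite /Kl subnn.
pose Kf k i := nth 0%N (Kl k) i.
have Kmono k i : (k < n)%N -> (Kf k i <= Kf k.+1 i)%N.
  move=> kn; have [_ om] := step k kn.
  by case: (Om_neq0_nth z_neq1 (etrans (Kl_size _) (esym (Kl_size _))) om i).
have Kint k i : (k < n)%N -> (Kf k.+1 i.+1 <= Kf k i)%N.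
  move=> kn; have [_ om] := step k kn.
  by case: (Om_neq0_nth z_neq1 (etrans (Kl_size _) (esym (Kl_size _))) om i).
have Kn i : Kf n i = nth 0%N mu i by rewrite /Kf Kln nth_pad.
have Kle k i : (k <= n)%N -> (Kf k i <= nth 0 mu i)%N.
  move=> kn; rewrite -Kn -(subKn kn); elim: (n - k)%N (leq_subr k n) => [|m IH] mn.
    by rewrite subn0.
  by apply: leq_trans (IH (ltnW mn)); rewrite -(subnSK mn); apply: Kmono; lia.
have Ksum k : (k <= n)%N -> (\sum_(i < size mu) Kf k i)%N = sumn (Kl k).
  move=> kn; rewrite (@sumn_nth (size mu)) // => i hi; apply/eqP.
  by rewrite -leqn0 -/(Kf k i); apply: leq_trans (Kle k i kn) _; rewrite nth_default.
have [|k kn|T HT TE] := shape_len_surj Hmu _ Kn Kmono Kint.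
- by move=> i; rewrite /Kf (sumn_eq0 Kl0) nth_nseq if_same.
- by rewrite !Ksum ?(ltnW kn) //; case: (step k kn).
exists T; first by rewrite mem_enum.
apply: (@eq_from_nth _ [::]); first by rewrite size_mkseq sch.
move=> j; rewrite sch => jn; rewrite nth_mkseq //.
have e : nth [::] ch j = Kl (n - j.+1)%N by rewrite /Kl subKn.
rewrite e; apply: (@eq_from_nth _ 0%N); first by rewrite Kl_size size_mkseq.
by move=> i _; rewrite nth_shape_seq TE // leq_subr.
Qed.

End TableauWeights.

(** * Comparison of the normalizing factors *)

Section BqPadded.

Variables (K : fieldType) (z : K).

Lemma Bq_cat_nseq0 la k : Bq z (la ++ nseq k 0%N) = Bq z la.
Proof.
elim: la => [|a la IH] /=; first by rewrite Bq_nseq0.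
by rewrite IH; case: (la) => //=; case: (k).
Qed.

Lemma Bq_gfact la : sorted geq la ->
  Bq z la = (1 - z) ^+ head 0%N la *
    \prod_(i < size la) gfact z (nth 0 la i - nth 0 la i.+1).
Proof.
elim: la => [|a la IH] srt; first by rewrite /= big_ord0 mulr1.
have le : (head 0%N la <= a)%N by case: la srt {IH} => //= b la /andP[].
rewrite [Bq _ _]/= IH ?(path_sorted srt) // big_ord_recl /= nth0 qpoch_gfact.
by rewrite -{3}(subnK le) exprD; ring.
Qed.

End BqPadded.

Lemma mulr_div_cancel (F : fieldType) (x y c h : F) : y != 0 ->
  x * (c * h) = x / y * (c * y * h).
Proof. by move=> y0; field. Qed.

Theorem theorem1p6
  (W : seq nat -> symfun Qq) (HW : is_qwhittaker W)
  (mu : seq nat) (Hmu : is_part mu)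
  (a : seq nat -> Qq) (Ha : expands_in (@msymf Qq) (sumn mu) (W mu) a)
  (nu : seq nat) (Hnu : is_part nu) (Hsize : sumn nu = sumn mu) :
  b_coef mu nu =
    (\prod_(i < size nu) qfact (nth 0%N nu i))
    / (\prod_(i < size mu) qfact (nth 0%N mu i - nth 0%N mu i.+1)%N)
    * a nu.
Proof.
set d := sumn mu in Ha Hsize *.
have pmu : mu \in parts d by rewrite mem_parts Hmu eqxx.
have pnu : nu \in parts d by rewrite mem_parts Hnu Hsize eqxx.
have -> : a nu = Acoef q d mu nu.
  by rewrite -(mcoeff_expand_msymf Ha pnu); apply: qwhittaker_mcoeff.
have -> : b_coef mu nu = (\prod_(k < size nu) gfact q (nth 0%N nu k)) *
    ((1 - q) ^+ head 0%N mu * Ah q d (pad d.+1 mu) (rev nu)).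
  exact: (sum_tableau_weights Hmu q_neq1 Hsize).
(* Both sides become multiples of the same [Ah] and share the power of 1 - q; what remains of
   [Bq mu] is the denominator of the theorem. *)
have -> : Acoef q d mu nu = (1 - q) ^+ head 0%N mu *
    (\prod_(i < size mu) gfact q (nth 0 mu i - nth 0 mu i.+1)) *
    Ah q d (pad d.+1 mu) (rev nu).
  rewrite /Acoef {1}/pad Bq_cat_nseq0 Bq_gfact; last by case/andP: Hmu.
  rewrite [pad d nu]/pad rev_cat rev_nseq Ah_nseq0 //; last first.
    by rewrite (size_vecs (pad_vecs pmu)) pad_vecs.
  exact: q_neq1.
apply: mulr_div_cancel; apply/prodf_neq0 => i _.
exact: (gfact_neq0 q_neq1).
Qed.
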